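(* Suppose that the stochastic basis $\{\mathcal{F}_n\}_{n\ge 0}$ is regular, let $1\le q<\infty$ and $\alpha\ge 0$. Then for every $1\le r<\infty$, $$BMO_{r,q}(\alpha)=BMO_{2,q}(\alpha)$$ in the sense of equivalent norms; that is, the two spaces consist of the same elements and there are constants $C_1,C_2>0$ (independent of $f$) such that $C_1\|f\|_{BMO_{2,q}(\alpha)}\le \|f\|_{BMO_{r,q}(\alpha)}\le C_2\|f\|_{BMO_{2,q}(\alpha)}$ for all $f$ in this common space.
   Context: Setting: $(\Omega,\mathcal{F},\mathbb{P})$ is a complete probability space and $\{\mathcal{F}_n\}_{n\ge 0}$ (the stochastic basis) is a nondecreasing sequence of sub-$\sigma$-algebras of $\mathcal{F}$ with $\mathcal{F}=\sigma(\bigcup_n\mathcal{F}_n)$. $\mathbb{E}$ is expectation and $\mathbb{E}_n$ is conditional expectation given $\mathcal{F}_n$. All martingales $f=(f_n)_{n\ge0}$ considered as elements of function spaces are relative to $\{\mathcal{F}_n\}$ and satisfy $f_0=0$. A function $f\in L_r$ ($1\le r\le\infty$) is identified with the martingale $f_n=\mathbb{E}_n f$ (so elements of $L_r$ are understood to satisfy $\mathbb{E}_0f=0$), and $f$ also denotes the limit $f_\infty$. Regularity: the stochastic basis is regular if there is an absolute constant $R>0$ such that $g_n\le R\,g_{n-1}$ a.e. for all $n\ge1$ and all nonnegative martingales $g=(g_n)_{n\ge0}$ (here $g_0$ is not required to vanish). Stopping times take values in $\{0,1,2,\dots\}\cup\{\infty\}$; for a stopping time $\nu$ the stopped martingale is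 $f^\nu=(f_{n\wedge\nu})_{n\ge0}$, and $f-f^\nu$ as a function means the difference of the limit functions (so it vanishes on $\{\nu=\infty\}$). Generalized BMO space: for $1\le r,q<\infty$, $\alpha\ge0$, $$BMO_{r,q}(\alpha)=\Big\{f\in L_r:\ \|f\|_{BMO_{r,q}(\alpha)}=\sup\frac{\sum_{k\in\mathbb{Z}}2^k\,\mathbb{P}(\nu_k<\infty)^{1-\frac1r}\|f-f^{\nu_k}\|_r}{\big(\sum_{k\in\mathbb{Z}}(2^k\mathbb{P}(\nu_k<\infty)^{1+\alpha})^q\big)^{1/q}}<\infty\Big\},$$ where the supremum is over all sequences of stopping times $\{\nu_k\}_{k\in\mathbb{Z}}$ with $\{2^k\mathbb{P}(\nu_k<\infty)^{1+\alpha}\}_{k\in\mathbb{Z}}\in\ell_q$ (with $0/0=0$). *)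

(* Defs.v *)
From HB Require Import structures.
From mathcomp Require Import all_boot all_order all_algebra.
From mathcomp Require Import all_classical all_reals all_analysis.

Set Implicit Arguments.
Unset Strict Implicit.
Unset Printing Implicit Defensive.

Import Order.TTheory GRing.Theory Num.Theory.
Import numFieldNormedType.Exports.

Local Open Scope classical_set_scope.
Local Open Scope ring_scope.

Definition stochastic_basis d (T : measurableType d) (F : nat -> set (set T)) :=
  [/\ forall n, sigma_algebra setT (F n),
      forall n, F n `<=` measurable,
      forall m n, (m <= n)%N -> F m `<=` F n &
      measurable = <<s \bigcup_n F n >> ].

Section conditional_expectation.
Context d (T : measurableType d) (R : realType) (P : probability T R).
Implicit Types (G : set (set T)) (f g : T -> R).

Definition is_condexp G f g :=
  [/\ preimage_set_system setT g measurable `<=` G,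
      P.-integrable setT (EFin \o g) &
      forall A, G A ->
        (\int[P]_(x in A) (g x)%:E = \int[P]_(x in A) (f x)%:E)%E].

(* A chosen version of E(f | G); it is the junk value 0 only when no version
   exists, which does not happen for integrable f and G a sub-sigma-algebra. *)
Definition condexp G f : T -> R := xget (cst 0) [set g | is_condexp G f g].

End conditional_expectation.

Section martingales.
Context d (T : measurableType d) (R : realType) (P : probability T R).
Variable F : nat -> set (set T).
Implicit Types (f : T -> R) (g : nat -> T -> R) (nu : T -> option nat).

(* The case m = n says that g n is integrable and F n-measurable. *)
Definition martingale g :=
  forall m n, (m <= n)%N -> is_condexp P (F m) (g n) (g m).

Definition regular_basis :=
  exists2 K : R, 0 < K &
    forall g, martingale g ->
      (forall n, \forall x \ae P, 0 <= g n x) ->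
      forall n, \forall x \ae P, g n.+1 x <= K * g n x.

Definition martingale_of f : nat -> T -> R := fun n => condexp P (F n) f.

(* None stands for the value oo. *)
Definition stopping_time nu :=
  forall n, F n [set x | if nu x is Some m then (m <= n)%N else false].

Definition stopped_set nu : set T := [set x | nu x != None].

Definition stopped g nu : nat -> T -> R :=
  fun n x => g (if nu x is Some m then minn n m else n) x.

(* Pointwise limit; for g = martingale_of f with f integrable, and for its
   stopped versions, it exists almost everywhere. *)
Definition limit_fun g : T -> R := fun x => limn (fun n => g n x).

(* The function f - f^nu, as the difference of the limits of the two
   martingales. *)
Definition sub_stopped f nu : T -> R :=
  limit_fun (martingale_of f) \- limit_fun (stopped (martingale_of f) nu).

End martingales.

Section BMO.
Context d (T : measurableType d) (R : realType) (P : probability T R).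
Variables (F : nat -> set (set T)) (r q alpha : R).
Implicit Types (f : T -> R) (nu : int -> T -> option nat).

Definition BMO_weight nu (k : int) : R :=
  2 ^ k * fine (P (stopped_set (nu k))) `^ (1 + alpha).

Definition lq_norm (a : int -> R) : \bar R :=
  ((\esum_(k in [set: int]) (`|a k| `^ q)%R%:E) `^ q^-1)%E.

Definition BMO_admissible nu :=
  (forall k, stopping_time F (nu k)) /\ (lq_norm (BMO_weight nu) < +oo)%E.

(* In \bar R, 0^-1 = +oo and 0 * +oo = 0, so that 0 / 0 = 0. *)
Definition BMO_ratio f nu : \bar R :=
  ((\esum_(k in [set: int])
      (2 ^ k * fine (P (stopped_set (nu k))) `^ (1 - r^-1))%R%:E
      * 'N[P]_(r%:E)[EFin \o sub_stopped P F f (nu k)])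
   / lq_norm (BMO_weight nu))%E.

Definition BMO_norm f : \bar R :=
  ereal_sup [set BMO_ratio f nu | nu in BMO_admissible].

Definition BMO : set (T -> R) :=
  [set f | [/\ f \in Lfun P r%:E,
               \forall x \ae P, martingale_of P F f 0%N x = 0 &
               (BMO_norm f < +oo)%E]].

End BMO.

(* Main.v *)
From HB Require Import structures.
Require Import Defs.
From mathcomp Require Import all_boot all_order all_algebra.
From mathcomp Require Import all_classical all_reals all_analysis.
From mathcomp Require Import finmap measurable_realfun simple_functions.
From mathcomp Require Import measurable_fun_approximation.
From mathcomp Require Import ring lra.

Set Implicit Arguments.
Unset Strict Implicit.
Unset Printing Implicit Defensive.

Import Order.TTheory GRing.Theory Num.Theory.
Import numFieldNormedType.Exports.

Local Open Scope classical_set_scope.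
Local Open Scope ring_scope.


(** For a stopping time nu write B = {nu < oo} and D_nu = f - f^nu, a function
    that vanishes off B. Every exponent is compared with the exponent 1.

    From r to 1 the comparison is Hoelder's inequality on B, stopping time by
    stopping time ([BMO_norm1_le_norm]).

    From 1 to s > 1 it is a John-Nirenberg argument. Pair D_nu with a bounded
    h >= 0, put h_n = E_n h, and let nu = sigma_0 <= sigma_1 <= ... where
    sigma_i is the first n >= nu with h_n > lam 2^i. As D_sigma is orthogonal to
    everything known at time sigma, telescoping gives
      int D_nu h = sum_i int D_(sigma_i) (h^(sigma_(i+1)) - h^(sigma_i)).
    Between sigma_i and sigma_(i+1) the martingale h_n is below lam 2^(i+1),
    except for its last jump, which by regularity multiplies it by at most K;
    and if h_n is already above that level at time sigma_i, then the two times
    agree. So the increments are at most K lam 2^(i+1), and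
      |int D_nu h| <= 2 K lam sum_i 2^i ||D_(sigma_i)||_1   ([key_estimate]),
    a finite sum because h is bounded. Take for h the function |D_nu|^(s-1),
    truncated and restricted to one sign of D_nu, and choose lam so that the
    maximal inequality reads
      P(sigma_i < oo)^(1-1/s) <= 2^-i P(B)^(1-1/s).
    This bounds P(B)^(1-1/s) ||D_nu||_s by the L_1 tails at the stopping times
    sigma_i ([local_estimate]).

    Now let (nu_k) be an admissible sequence. For each fixed i the sequence
    k |-> sigma_(k,i) is admissible too, with an l_q norm smaller by the factor
    rho^i, rho = 2^(-1/(1-1/s)) < 1/2. The definition of the norm with exponent
    1 applies to it, and the sum over i with the weights 2^i converges
    ([family_bound]). Truncations are removed by monotone convergence
    ([BMO_num_bound]).

    The argument rests on three facts about martingales: conditional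
    expectations exist ([condexpP]), f^nu is the conditional expectation of f
    given the sigma-algebra of nu ([stopped_value_condexp]), and E_n f converges
    to f almost everywhere ([levy_upward]), which identifies the pointwise limits
    in the definition of f - f^nu ([sub_stopped_ae]). *)

(** * Sums of extended real numbers *)

Lemma ereal_cvg0_le (R : realType) (u : nat -> \bar R) (e : R) : 0 < e ->
  u @ \oo --> 0%E -> exists n, (u n <= e%:E)%E.
Proof.
move=> e0 /fine_cvgP[ufin /cvgrPdist_le/(_ _ e0) ue].
have : \forall n \near \oo, (u n <= e%:E)%E.
  apply: filterS2 ufin ue => n un; rewrite sub0r normrN /= => une.
  by rewrite -(fineK un) lee_fin (le_trans (ler_norm _)).
by case=> n _ /(_ n (leqnn n)); exists n.
Qed.

Section ereal_sums.
Context (R : realType).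
Local Open Scope ereal_scope.

Lemma esum_mulr_le (I : choiceType) (c : R) (a : I -> \bar R) : (0 <= c)%R ->
  (forall i, 0 <= a i) ->
  \esum_(i in [set: I]) (c%:E * a i) <= c%:E * \esum_(i in [set: I]) a i.
Proof.
move=> c0 a0; apply: ge_ereal_sup => _ [X [finX _] <-].
rewrite -ge0_mule_fsumr//; apply: lee_wpmul2l; first by rewrite lee_fin.
by apply: ereal_sup_ubound; exists X.
Qed.

Lemma esumZ (I : choiceType) (c : R) (a : I -> \bar R) : (0 < c)%R ->
  (forall i, 0 <= a i) ->
  \esum_(i in [set: I]) (c%:E * a i) = c%:E * \esum_(i in [set: I]) a i.
Proof.
move=> c0 a0; apply/eqP; rewrite eq_le; apply/andP; split.
  by apply: esum_mulr_le => //; exact: ltW.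
have ci0 : (0 < c^-1)%R by rewrite invr_gt0.
have H := @esum_mulr_le I c^-1 (fun i => c%:E * a i) (ltW ci0).
apply: (@le_trans _ _ (c%:E * (c^-1%:E * \esum_(i in [set: I]) (c%:E * a i)))).
  apply: lee_wpmul2l; first by rewrite lee_fin ltW.
  apply: le_trans (H _); last by move=> i; rewrite mule_ge0// lee_fin ltW.
  by apply: le_esum => i _; rewrite muleA -EFinM mulVf ?gt_eqF// mul1e.
by rewrite muleA -EFinM divff ?gt_eqF// mul1e.
Qed.

Lemma esum_swap (I J : choiceType) (a : I -> J -> \bar R) :
  (forall i j, 0 <= a i j) ->
  \esum_(i in [set: I]) \esum_(j in [set: J]) a i j =
  \esum_(j in [set: J]) \esum_(i in [set: I]) a i j.
Proof.
move=> a0; rewrite !esum_esum//.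
rewrite (@reindex_esum _ _ _ ([set: J] `*`` (fun=> [set: I])) _ (fun x => (x.2, x.1)))//.
split => //.
- by move=> [? ?] [? ?] _ _ /= [-> ->].
- by move=> [i j] _ /=; exists (j, i).
Qed.

Lemma esum_geometric_le (z : R) (c : \bar R) : (0 < z < 1)%R -> 0 <= c ->
  \esum_(i in [set: nat]) ((z ^+ i)%:E * c) <= ((1 - z)^-1)%:E * c.
Proof.
move=> /andP[z0 z1] c0; apply: ge_ereal_sup => _ [X [finX _] <-].
rewrite fsbig_finite//= -ge0_sume_distrl; last first.
  by move=> i _; rewrite lee_fin exprn_ge0// ltW.
apply: lee_wpmul2r => //; rewrite -fsbig_finite//.
apply: (@le_trans _ _ (\esum_(i in [set: nat]) (z ^+ i)%:E)).
  by apply: ereal_sup_ubound; exists X.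
rewrite -nneseries_esumT; last by move=> i; rewrite lee_fin exprn_ge0// ltW.
apply: lime_le.
  by apply: is_cvg_nneseries => i _ _; rewrite lee_fin exprn_ge0// ltW.
apply: nearW => n; rewrite sumEFin lee_fin.
have := @geometric_le_lim R n 1 z ler01 z0; rewrite (ger0_norm (ltW z0)) => /(_ z1).
rewrite mul1r; apply: le_trans; rewrite /series /=.
by apply: ler_sum => i _; rewrite /geometric /= mul1r.
Qed.

Lemma le_sum_esum (r : nat -> R) I : (forall i, (0 <= r i)%R) ->
  (\sum_(i < I) r i)%:E <= \esum_(i in [set: nat]) (r i)%:E.
Proof.
move=> r0; rewrite -nneseries_esumT; last by move=> n; rewrite lee_fin.
rewrite -sumEFin -(big_mkord xpredT (fun i => (r i)%:E)).
by apply: nneseries_lim_ge => i _ _; rewrite lee_fin.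
Qed.

Lemma inve_ge0 (x : \bar R) : 0 <= x -> 0 <= x^-1.
Proof.
case: x => [x| |]//; rewrite ?invey// inver; case: ifP => // _.
by rewrite !lee_fin invr_ge0.
Qed.

Lemma le_poweR (r : R) (x y : \bar R) : (0 <= r)%R -> 0 <= x -> x <= y ->
  x `^ r <= y `^ r.
Proof.
move=> r0 x0 xy; apply: gt0_ler_poweR => //; rewrite in_itv /= leey andbT//.
exact: le_trans xy.
Qed.

Lemma lq_norm_scale (q c : R) (a b : int -> R) : (0 < q)%R -> (0 < c)%R ->
  (forall k, (0 <= a k)%R) -> (forall k, (a k <= c * b k)%R) ->
  lq_norm q a <= c%:E * lq_norm q b.
Proof.
move=> q0 c0 a0 ab; rewrite /lq_norm.
have b0 k : (0 <= b k)%R.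
  by have := le_trans (a0 k) (ab k); rewrite pmulr_rge0.
rewrite [X in X * _](_ : _ = (c `^ q)%:E `^ q^-1); last first.
  by rewrite poweR_EFin -powRrM divff ?gt_eqF// powRr1// (ltW c0).
have E0 (e : int -> R) : 0 <= \esum_(k in [set: int]) (`|e k| `^ q)%:E.
  by apply: esum_ge0 => k _; rewrite lee_fin powR_ge0.
rewrite -poweRM ?lee_fin ?powR_ge0//.
apply: le_poweR => //; first by rewrite invr_ge0 ltW.
rewrite -esumZ ?powR_gt0//; apply: le_esum => k _.
rewrite -EFinM lee_fin -powRM ?(ltW c0)//.
apply: ge0_ler_powR; [exact: ltW|by rewrite nnegrE| |by rewrite !ger0_norm].
by rewrite nnegrE mulr_ge0 ?(ltW c0).
Qed.

Lemma lq_norm_ge0 (q : R) (a : int -> R) : 0 <= lq_norm q a.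
Proof. exact: poweR_ge0. Qed.

End ereal_sums.

(** * Conditional expectations *)

Section condexp.
Context d (T : measurableType d) (R : realType) (P : probability T R).
Implicit Types (G : set (set T)) (f g h Y : T -> R).

Definition sub_sigma G := sigma_algebra setT G /\ G `<=` measurable.

(** Measurability with respect to a sub-sigma-algebra, stated on the type that
    carries it, so that the usual closure properties apply verbatim. *)
Definition Gmeasurable G f :=
  measurable_fun setT (f : g_sigma_algebraType G -> R).

Lemma GmeasurableP G f : sigma_algebra setT G ->
  Gmeasurable G f <-> preimage_set_system setT f measurable `<=` G.
Proof.
move=> sG; rewrite -{2}(measurable_g_measurableTypeE sG); split.
  by move=> mf _ [B mB <-]; exact: mf.
by move=> mf _ B mB; apply: mf; exists B.
Qed.

Lemma Gmeasurable_measurable G f : sub_sigma G -> Gmeasurable G f ->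
  measurable_fun setT f.
Proof.
move=> [sG Gm] mf _ B mB; apply: Gm.
by rewrite -(measurable_g_measurableTypeE sG); exact: mf.
Qed.

Lemma integrable_measurable f :
  P.-integrable setT (EFin \o f) -> measurable_fun setT f.
Proof. by move=> /measurable_int /measurable_EFinP. Qed.

Lemma is_condexp_meas G f g : sub_sigma G -> is_condexp P G f g ->
  Gmeasurable G g.
Proof. by move=> [sG _] [gG _ _]; apply/GmeasurableP. Qed.

(** The Radon-Nikodym derivative, on the sigma-algebra G, of the signed measure
    with density f. *)
Lemma condexpP G f : sub_sigma G -> P.-integrable setT (EFin \o f) ->
  is_condexp P G f (condexp P G f).
Proof.
move=> [sG Gm] fi; rewrite /condexp.
suff [g gP] : exists g, is_condexp P G f g by apply: xgetI gP.
pose G' := g_sigma_algebraType G.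
pose phi : T -> G' := idfun.
have mphi : measurable_fun setT phi.
  move=> _ A mA; rewrite setTI; apply: Gm.
  by rewrite -(measurable_g_measurableTypeE sG).
have mI := isMeasurableFun.Build _ _ _ _ _ mphi.
pose phi' : {mfun T >-> G'} := HB.pack phi mI.
have [nu nuE] : exists nu : {charge set G' -> \bar R},
    forall A, nu A = (\int[P]_(x in A) (f x)%:E)%E.
  have @nu : {charge set G' -> \bar R}.
    refine (pushforward (induced_charge fi) phi' : {charge set G' -> \bar R}).
    exact: mphi.
  by exists nu.
pose PG : {finite_measure set G' -> \bar R} := distribution P phi'.
have PGE (A : set T) : PG A = P A by [].
have GE (A : set T) : measurable (A : set G') -> measurable A.
  by move=> mA; rewrite -[A]setTI; exact: mphi.
have nuPG : nu `<< PG.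
  apply/null_content_dominatesP => A mA PA0; rewrite nuE.
  apply: null_set_integral => //; first exact: GE.
  exact: measurable_funS (measurable_int _ fi).
pose g := fine \o Radon_Nikodym nu PG.
have gE x : (g x)%:E = Radon_Nikodym nu PG x.
  by rewrite fineK// Radon_Nikodym_fin_num.
have gi : PG.-integrable setT (EFin \o g).
  by apply: eq_integrable (Radon_Nikodym_integrable nuPG) => // x _ /=; rewrite gE.
have mg : Gmeasurable G g by move/measurable_int : gi => /measurable_EFinP.
have giP : P.-integrable setT (EFin \o g).
  apply/integrableP; split.
    by apply/measurable_EFinP; exact: Gmeasurable_measurable mg.
  case/integrableP : gi => _; apply: le_lt_trans.
  rewrite ge0_integral_pushforward//.
  apply: measurableT_comp => //; exact/measurable_EFinP.
exists g; split => //; first exact/GmeasurableP.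
move=> A GA; have mA : measurable (A : set G').
  by rewrite (measurable_g_measurableTypeE sG).
rewrite -nuE (Radon_Nikodym_integral nuPG)//.
under [RHS]eq_integral do rewrite -gE.
rewrite integral_pushforward//; first exact/measurable_EFinP.
by apply: integrableS giP => //; exact: GE.
Qed.

Lemma integral_sub_eq0 (u v : T -> R) A : measurable A ->
  P.-integrable setT (EFin \o u) -> P.-integrable setT (EFin \o v) ->
  (\int[P]_(x in A) (u x)%:E = \int[P]_(x in A) (v x)%:E)%E ->
  (\int[P]_(x in A) (u x - v x)%:E = 0)%E.
Proof.
move=> mA ui vi uv.
have uiA : P.-integrable A (EFin \o u) by exact: integrableS ui.
have viA : P.-integrable A (EFin \o v) by exact: integrableS vi.
under eq_integral do rewrite EFinB.
rewrite integralB_EFin// uv subee//; exact: integrable_fin_num.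
Qed.

Import HBNNSimple.

(** The hypothesis says that u is orthogonal to indicators of G, hence to simple
    functions; dominated convergence with the dominating function |u Y| allows
    the factors u and Y to be both unbounded. *)
Let orthogonal_ge0 G (u Y : T -> R) : sub_sigma G ->
  P.-integrable setT (EFin \o u) ->
  (forall A, G A -> (\int[P]_(x in A) (u x)%:E = 0)%E) ->
  Gmeasurable G Y -> (forall x, 0 <= Y x) ->
  P.-integrable setT (fun x => (u x * Y x)%:E) ->
  (\int[P]_x (u x * Y x)%:E = 0)%E.
Proof.
move=> Gs ui u0 mY Y0 uYi; have [sG Gm] := Gs.
have mu := integrable_measurable ui.
have mEY : measurable_fun setT (EFin \o Y : g_sigma_algebraType G -> \bar R).
  exact/measurable_EFinP.
pose h := nnsfun_approx measurableT mEY.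
have h0 n x : 0 <= h n x by [].
have hY n x : h n x <= Y x.
  by rewrite -lee_fin /h nnsfun_approxE; apply: le_approx => // y _; rewrite lee_fin.
have mh n : measurable_fun setT (h n : T -> R).
  by apply: (Gmeasurable_measurable Gs); exact: measurable_funP.
have uh0 n : (\int[P]_x (u x * h n x)%:E = 0)%E.
  pose s := fset_set (range (h n)).
  transitivity (\int[P]_x (\sum_(y <- s)
      y%:E * ((EFin \o u) \_ (h n @^-1` [set y])) x))%E.
    apply: eq_integral => x _; rewrite fimfunE fsbig_finite//= mulr_sumr -sumEFin.
    apply: eq_bigr => y _; rewrite /patch indicE.
    by case: (x \in _) => /=; rewrite ?mulr1 ?mulr0 ?mule0// mulrC EFinM.
  have mpre y : G (h n @^-1` [set y]).
    have : measurable ((h n : g_sigma_algebraType G -> R) @^-1` [set y]) by [].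
    by rewrite (measurable_g_measurableTypeE sG).
  rewrite integral_sum//.
    apply: big1 => y _; rewrite integralZl//.
      by rewrite -integral_mkcond u0 ?mule0.
    apply/(integrable_mkcond _ (Gm _ (mpre y))); apply: integrableS ui => //; exact: Gm.
  move=> y; apply: integrableZl => //.
  apply/(integrable_mkcond _ (Gm _ (mpre y))); apply: integrableS ui => //; exact: Gm.
have [|||||_ _] := @dominated_convergence _ _ _ P setT measurableT
    (fun n x => (u x * h n x)%:E) (fun x => (u x * Y x)%:E)
    (fun x => `|(u x * Y x)%:E|)%E.
- by move=> n; apply/measurable_EFinP; exact: measurable_funM.
- exact: measurable_int uYi.
- apply: aeW => x _; under eq_fun do rewrite EFinM; rewrite EFinM.
  apply: cvgeZl => //; apply: cvg_nnsfun_approx => // y _.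
  by rewrite lee_fin.
- exact: integrable_abse.
- apply: aeW => x n _; rewrite lee_fin !normrM ler_wpM2l//.
  by rewrite !ger0_norm.
by under eq_fun do rewrite uh0; move/cvg_lim => <- //; rewrite lim_cst.
Qed.

Lemma orthogonal_Gmeasurable G (u Y : T -> R) : sub_sigma G ->
  P.-integrable setT (EFin \o u) ->
  (forall A, G A -> (\int[P]_(x in A) (u x)%:E = 0)%E) ->
  Gmeasurable G Y ->
  P.-integrable setT (fun x => (u x * Y x)%:E) ->
  (\int[P]_x (u x * Y x)%:E = 0)%E.
Proof.
move=> Gs ui u0 mY uYi.
have mu := integrable_measurable ui.
have mYp : Gmeasurable G Y^\+ by exact: measurable_funrpos.
have mYn : Gmeasurable G Y^\- by exact: measurable_funrneg.
have ip : P.-integrable setT (fun x => (u x * Y^\+ x)%:E).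
  apply: le_integrable uYi => //.
    apply/measurable_EFinP; apply: measurable_funM => //.
    exact: Gmeasurable_measurable mYp.
  move=> x _; rewrite lee_fin !normrM ler_wpM2l// ger0_norm ?funrpos_ge0//.
  by rewrite /funrpos ge_max normr_ge0 ler_norm.
have iN : P.-integrable setT (fun x => (u x * Y^\- x)%:E).
  apply: le_integrable uYi => //.
    apply/measurable_EFinP; apply: measurable_funM => //.
    exact: Gmeasurable_measurable mYn.
  move=> x _; rewrite lee_fin !normrM ler_wpM2l// ger0_norm ?funrneg_ge0//.
  by rewrite /funrneg ge_max normr_ge0 -normrN ler_norm.
transitivity (\int[P]_x ((u x * Y^\+ x)%:E - (u x * Y^\- x)%:E))%E.
  by apply: eq_integral => x _; rewrite -EFinB -mulrBr -[in LHS](funrposBneg Y).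
rewrite integralB_EFin//.
by rewrite !(@orthogonal_ge0 G)// ?sube0// => x; rewrite ?funrpos_ge0 ?funrneg_ge0.
Qed.

(** The set where the inequality fails is a test set in G, on which it
    contradicts the comparison of the integrals. *)
Lemma Gmeasurable_le_ae G (A : set T) g g' : sub_sigma G -> G A ->
  Gmeasurable G g -> Gmeasurable G g' ->
  P.-integrable setT (EFin \o g) -> P.-integrable setT (EFin \o g') ->
  (forall B, G B -> B `<=` A ->
    (\int[P]_(x in B) (g x)%:E <= \int[P]_(x in B) (g' x)%:E)%E) ->
  \forall x \ae P, A x -> g x <= g' x.
Proof.
move=> Gs GA mg mg' gi gi' H; have [sG Gm] := Gs.
pose B := A `&` [set x | 0 < (g \- g') x].
have mGG' : Gmeasurable G (g \- g') by exact: measurable_funB.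
have GB : G B.
  rewrite -(measurable_g_measurableTypeE sG); apply: measurableI.
    by rewrite (measurable_g_measurableTypeE sG).
  rewrite (_ : [set x | _] = setT `&` (g \- g') @^-1` `]0, +oo[); last first.
    by apply/seteqP; split => x /=; rewrite in_itv/= andbT// => -[].
  exact: mGG'.
have mB := Gm _ GB.
have giB : P.-integrable B (EFin \o g) by exact: integrableS gi.
have giB' : P.-integrable B (EFin \o g') by exact: integrableS gi'.
have mgg' : measurable_fun B (fun x => (g x - g' x)%:E).
  apply/measurable_EFinP; apply: measurable_funS (measurableT) _ _ => //.
  exact: Gmeasurable_measurable mGG'.
have int0 : (\int[P]_(x in B) `|(g x - g' x)%:E| = 0)%E.
  apply/eqP; rewrite eq_le integral_ge0 ?andbT//.
  rewrite (eq_integral (fun x => (g x)%:E - (g' x)%:E)%E); last first.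
    by move=> x /set_mem[_ /= /ltW ?]; rewrite ger0_norm.
  rewrite integralB_EFin// leeBlDr ?integrable_fin_num//.
  by rewrite add0e; apply: H => // x [].
have := (ae_eq_integral_abs P mB mgg').1 int0.
apply: filterS => x /= Bx Ax; rewrite leNgt; apply/negP => gg'.
have /Bx : B x by split => //=; rewrite subr_gt0.
by case=> /eqP; rewrite subr_eq0 => /eqP e; rewrite e ltxx in gg'.
Qed.

Lemma Gmeasurable_eq_ae G (A : set T) g g' : sub_sigma G -> G A ->
  Gmeasurable G g -> Gmeasurable G g' ->
  P.-integrable setT (EFin \o g) -> P.-integrable setT (EFin \o g') ->
  (forall B, G B -> B `<=` A ->
    (\int[P]_(x in B) (g x)%:E = \int[P]_(x in B) (g' x)%:E)%E) ->
  \forall x \ae P, A x -> g x = g' x.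
Proof.
move=> Gs GA mg mg' gi gi' H.
have H1 := @Gmeasurable_le_ae G A g g' Gs GA mg mg' gi gi'.
have H2 := @Gmeasurable_le_ae G A g' g Gs GA mg' mg gi' gi.
have /H1 : (forall B, G B -> B `<=` A ->
    (\int[P]_(x in B) (g x)%:E <= \int[P]_(x in B) (g' x)%:E)%E).
  by move=> B GB BA; rewrite H.
have /H2 : (forall B, G B -> B `<=` A ->
    (\int[P]_(x in B) (g' x)%:E <= \int[P]_(x in B) (g x)%:E)%E).
  by move=> B GB BA; rewrite H.
by apply: filterS2 => x xA x'A Ax; apply/eqP; rewrite eq_le xA// x'A.
Qed.

Lemma sub_sigmaT G : sub_sigma G -> G setT.
Proof.
move=> [[G0 GC _] _]; have := GC _ G0; by rewrite setD0.
Qed.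

Lemma is_condexp_eq_ae G f g g' : sub_sigma G ->
  is_condexp P G f g -> is_condexp P G f g' -> \forall x \ae P, g x = g' x.
Proof.
move=> Gs fg fg'; have [_ gi fgE] := fg; have [_ gi' fgE'] := fg'.
have := Gmeasurable_eq_ae Gs (sub_sigmaT Gs) (is_condexp_meas Gs fg)
  (is_condexp_meas Gs fg') gi gi'.
move=> /(_ _)/wrap[]; first by move=> B GB _; rewrite fgE// fgE'.
by apply: filterS => x; exact.
Qed.

Lemma is_condexp_le_ae G f f' g g' : sub_sigma G ->
  P.-integrable setT (EFin \o f) -> P.-integrable setT (EFin \o f') ->
  is_condexp P G f g -> is_condexp P G f' g' ->
  (\forall x \ae P, f x <= f' x) -> \forall x \ae P, g x <= g' x.
Proof.
move=> Gs fi fi' fg fg' ff'; have [_ gi fgE] := fg; have [_ gi' fgE'] := fg'.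
have := Gmeasurable_le_ae Gs (sub_sigmaT Gs) (is_condexp_meas Gs fg)
  (is_condexp_meas Gs fg') gi gi'.
move=> /(_ _)/wrap[]; last by apply: filterS => x; exact.
move=> B GB _; rewrite fgE// fgE'//.
have mB := Gs.2 _ GB.
have iB := integrableS measurableT mB (@subsetT _ B) fi.
have iB' := integrableS measurableT mB (@subsetT _ B) fi'.
rewrite -sube_ge0 ?integrable_fin_num// -integralB_EFin//.
pose w x := Num.max 0 (f' x - f x).
rewrite (ae_eq_integral (EFin \o w))//.
- by apply: integral_ge0 => x _; rewrite lee_fin le_max lexx.
- apply: emeasurable_funB; first exact: measurable_int iB'.
  exact: measurable_int iB.
- apply/measurable_EFinP; apply: measurable_funS measurableT _ _ => //.
  by apply: measurable_maxr => //; apply: measurable_funB;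
    [exact: integrable_measurable fi'|exact: integrable_measurable fi].
- apply: filterS ff' => x ff' _ /=; rewrite /w -EFinB; congr EFin.
  by rewrite max_r// subr_ge0.
Qed.

Lemma is_condexp_linear G (a : R) f f' g g' : sub_sigma G ->
  P.-integrable setT (EFin \o f) -> P.-integrable setT (EFin \o f') ->
  is_condexp P G f g -> is_condexp P G f' g' ->
  is_condexp P G (fun x => a * f x + f' x) (fun x => a * g x + g' x).
Proof.
move=> Gs fi fi' fg fg'; have [_ gi fgE] := fg; have [_ gi' fgE'] := fg'.
have E (u v : T -> R) A : P.-integrable setT (EFin \o u) ->
    P.-integrable setT (EFin \o v) -> measurable A ->
    (\int[P]_(x in A) (a * u x + v x)%:E =
     a%:E * \int[P]_(x in A) (u x)%:E + \int[P]_(x in A) (v x)%:E)%E.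
  move=> ui vi mA.
  have uA := integrableS measurableT mA (@subsetT _ A) ui.
  have vA := integrableS measurableT mA (@subsetT _ A) vi.
  under eq_integral do rewrite EFinD EFinM.
  by rewrite integralD ?integralZl//; exact: integrableZl.
split.
- apply/GmeasurableP; first exact: Gs.1.
  apply: measurable_funD; last exact: is_condexp_meas fg'.
  by apply: measurable_funM => //; exact: is_condexp_meas fg.
- have := integrableD measurableT (integrableZl measurableT a gi) gi'.
  by apply: eq_integrable => // x _ /=; rewrite EFinD EFinM.
- move=> A GA; have mA := Gs.2 _ GA.
  by rewrite !E// fgE// fgE'.
Qed.

Lemma is_condexp_id G f : sub_sigma G -> Gmeasurable G f ->
  P.-integrable setT (EFin \o f) -> is_condexp P G f f.
Proof. by move=> Gs mf fi; split => //; apply/GmeasurableP => //; exact: Gs.1. Qed.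

Lemma is_condexpN (G : set (set T)) f g : sub_sigma G ->
  P.-integrable setT (EFin \o f) ->
  is_condexp P G f g -> is_condexp P G (fun x => - f x) (fun x => - g x).
Proof.
move=> Gs fi fg.
have i0 : P.-integrable setT (EFin \o cst 0) by exact: finite_measure_integrable_cst.
have c0 : is_condexp P G (cst 0) (cst 0).
  by apply: is_condexp_id => //; exact: measurable_cst.
have := is_condexp_linear (-1) Gs fi i0 fg c0.
by congr is_condexp; apply/funext => x /=; rewrite mulN1r addr0.
Qed.

Lemma bounded_integrable h (M : R) : measurable_fun setT h ->
  (forall x, 0 <= h x <= M) -> P.-integrable setT (EFin \o h).
Proof.
move=> mh hM.
have Mi : P.-integrable setT (EFin \o cst M) by exact: finite_measure_integrable_cst.
apply: le_integrable Mi => //; first exact/measurable_EFinP.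
by move=> x _; have /andP[h0 hm] := hM x; rewrite lee_fin !ger0_norm// (le_trans h0).
Qed.

Lemma is_condexp_bounds G h g (M : R) : sub_sigma G ->
  P.-integrable setT (EFin \o h) -> is_condexp P G h g ->
  (forall x, 0 <= h x <= M) -> \forall x \ae P, 0 <= g x <= M.
Proof.
move=> Gs hi hE hM.
have ci (a : R) : P.-integrable setT (EFin \o cst a).
  exact: finite_measure_integrable_cst.
have cc (a : R) : is_condexp P G (cst a) (cst a).
  by apply: is_condexp_id => //; exact: measurable_cst.
have A1 : \forall x \ae P, g x <= cst M x.
  apply: (is_condexp_le_ae Gs hi (ci M) hE (cc M)).
  by apply: aeW => x; have /andP[] := hM x.
have A2 : \forall x \ae P, cst 0 x <= g x.
  apply: (is_condexp_le_ae Gs (ci 0) hi (cc 0) hE).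
  by apply: aeW => x; have /andP[] := hM x.
by apply: filterS2 A1 A2 => x /= -> ->.
Qed.

Lemma integrableM_ae (u v : T -> R) (M : R) : 0 <= M ->
  P.-integrable setT (EFin \o u) -> measurable_fun setT v ->
  (\forall x \ae P, `|v x| <= M) ->
  P.-integrable setT (fun x => (u x * v x)%:E).
Proof.
move=> M0 ui mv vM; have mu := integrable_measurable ui.
apply/integrableP; split.
  by apply/measurable_EFinP; exact: measurable_funM.
have /integrableP[_] := integrableZl measurableT M ui.
apply: le_lt_trans; apply: ae_ge0_le_integral => //.
- by apply/measurable_EFinP; apply: measurableT_comp => //; exact: measurable_funM.
- by apply/measurable_EFinP; apply: measurableT_comp => //; exact: measurable_funM.
apply: filterS vM => x vM _; rewrite -EFinM /= lee_fin !normrM mulrC.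
by rewrite ler_wpM2r// (ger0_norm M0).
Qed.

Lemma orthogonal_condexp G (f g Y : T -> R) : sub_sigma G ->
  P.-integrable setT (EFin \o f) -> is_condexp P G f g -> Gmeasurable G Y ->
  P.-integrable setT (fun x => ((f x - g x) * Y x)%:E) ->
  (\int[P]_x ((f x - g x) * Y x)%:E = 0)%E.
Proof.
move=> Gs fi fg mY iY; have [_ gi fgE] := fg.
apply: (orthogonal_Gmeasurable Gs _ _ mY iY).
  have := integrableB measurableT fi gi.
  by apply: eq_integrable => // x _ /=; rewrite EFinB.
by move=> A GA; apply: integral_sub_eq0 => //; [exact: Gs.2|rewrite fgE].
Qed.

End condexp.

(** * Stopping times and stopped martingales *)

Section stopping.
Context d (T : measurableType d) (R : realType) (P : probability T R).
Variable F : nat -> set (set T).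
Hypothesis Fs : forall n, sub_sigma (F n).
Hypothesis Fmono : forall m n, (m <= n)%N -> F m `<=` F n.
Implicit Types (f g : T -> R) (nu : T -> option nat).

Lemma F_setI n A B : F n A -> F n B -> F n (A `&` B).
Proof.
move=> FA FB; rewrite -(measurable_g_measurableTypeE (Fs n).1).
by apply: measurableI; rewrite (measurable_g_measurableTypeE (Fs n).1).
Qed.

Lemma F_setD n A B : F n A -> F n B -> F n (A `\` B).
Proof.
move=> FA FB; rewrite -(measurable_g_measurableTypeE (Fs n).1).
by apply: measurableD; rewrite (measurable_g_measurableTypeE (Fs n).1).
Qed.

Lemma F_bigsetU n m (A : nat -> set T) : (forall i, (i < m)%N -> F n (A i)) ->
  F n (\big[setU/set0]_(i < m) A i).
Proof.
move=> FA; rewrite -(measurable_g_measurableTypeE (Fs n).1).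
apply: bigsetU_measurable => i _; rewrite (measurable_g_measurableTypeE (Fs n).1).
exact: FA.
Qed.

Lemma stopping_timeP nu :
  stopping_time F nu <-> forall n, F n [set x | nu x = Some n].
Proof.
split => [st [|n]|H n].
- rewrite (_ : [set x | _] = [set x | if nu x is Some m then (m <= 0)%N else false]).
    exact: st.
  apply/seteqP; split => x /=; first by move=> ->.
  by case: (nu x) => [m|//]; rewrite leqn0 => /eqP ->.
- rewrite (_ : [set x | _] = [set x | if nu x is Some m then (m <= n.+1)%N else false]
    `\` [set x | if nu x is Some m then (m <= n)%N else false]).
    by apply: F_setD; [exact: st|apply: (Fmono (leqnSn n)); exact: st].
  apply/seteqP; split => x /=; first by move=> ->; rewrite leqnn ltnn.
  case: (nu x) => [m|[]//]; rewrite leq_eqVlt => -[/orP[/eqP -> //|]].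
  by rewrite ltnS => ->.
- rewrite (_ : [set x | _] = \big[setU/set0]_(m < n.+1) [set x | nu x = Some (m : nat)]).
    by apply: (@F_bigsetU n n.+1 (fun m => [set x | nu x = Some m])) => i;
      rewrite ltnS => /Fmono; apply; exact: H.
  rewrite -(bigcup_mkord _ (fun m => [set x | nu x = Some m])); apply/seteqP; split => x /=.
    by case E : (nu x) => [m|//] mn; exists m; rewrite //= ltnS.
  by move=> [m /=]; rewrite ltnS => mn ->.
Qed.

(** The events known at time nu; past an infinite time every event is known. *)
Definition stopped_algebra nu : set (set T) :=
  [set A | measurable A /\ forall n, F n (A `&` [set x | nu x = Some n])].

Lemma stopped_algebra_sub nu : stopping_time F nu ->
  sub_sigma (stopped_algebra nu).
Proof.
move=> /stopping_timeP st; split; last by move=> A [].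
split.
- by split => // n; rewrite set0I; have [[]] := Fs n.
- move=> A [mA FA]; split; first by rewrite setTD; exact: measurableC.
  move=> n; rewrite (_ : _ `&` _ =
    [set x | nu x = Some n] `\` (A `&` [set x | nu x = Some n])).
    by apply: F_setD.
  apply/seteqP; split => x /= -[]; first by move=> [_ Ax] ->; split => // -[].
  by move=> -> nA; split => //; split => // Ax; exact: nA.
- move=> A H; split; first by apply: bigcup_measurable => i _; have [] := H i.
  move=> n; rewrite setI_bigcupl; have [[_ _ U] _] := Fs n.
  by apply: U => i; have [_] := H i.
Qed.

Lemma measurable_stopping_level nu (o : option nat) : stopping_time F nu ->
  measurable [set x | nu x = o].
Proof.
move=> /stopping_timeP st; case: o => [n|]; first exact: (Fs n).2.
rewrite (_ : [set x | _] = ~` (\bigcup_n [set x | nu x = Some n])).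
  by apply: measurableC; apply: bigcup_measurable => n _; exact: (Fs n).2.
apply/seteqP; split => x /=; first by move=> E [n _] /=; rewrite E.
by case E : (nu x) => [n|//] H; exfalso; apply: H; exists n.
Qed.

Lemma measurable_stopped_set nu : stopping_time F nu ->
  measurable (stopped_set nu).
Proof.
move=> st; rewrite (_ : stopped_set nu = ~` [set x | nu x = None]).
  by apply: measurableC; exact: measurable_stopping_level.
by apply/seteqP; split => x /= /eqP.
Qed.

(** f stands for the limit of the martingale. *)
Definition stopped_value (fn : nat -> T -> R) f nu : T -> R :=
  fun x => if nu x is Some n then fn n x else f x.

(** On {nu = n} a set of the stopped sigma-algebra belongs to F n, and on
    {nu = oo} every measurable set is allowed; so the stopped value has there the
    same integrals as the conditional expectation of f, with which it therefore
    agrees almost everywhere. Its integrability follows. *)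
Lemma stopped_value_condexp nu f (fn : nat -> T -> R) : stopping_time F nu ->
  P.-integrable setT (EFin \o f) ->
  (forall n, is_condexp P (F n) f (fn n)) ->
  is_condexp P (stopped_algebra nu) f (stopped_value fn f nu).
Proof.
move=> st fi ffn; have Gs := stopped_algebra_sub st.
have stE n : F n [set x | nu x = Some n] by move/stopping_timeP : st.
set G := stopped_algebra nu in Gs *.
pose val (o : option nat) := if o is Some n then fn n else f.
have vali o : P.-integrable setT (EFin \o val o).
  by case: o => [n|//]; have [] := ffn n.
have mval o : measurable_fun setT (val o) by exact: integrable_measurable (vali o).
(* An enumeration of the possible values of a stopping time. *)
pose onat n : option nat := if n is m.+1 then Some m else None.
have onatK o : onat (oapp succn 0%N o) = o by case: o.
pose A o := [set x | nu x = o].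
have GA o : G (A o).
  split; first exact: measurable_stopping_level.
  move=> n; have [->|on] := eqVneq o (Some n); first by rewrite setIid.
  rewrite (_ : _ `&` _ = set0); first by have [[]] := Fs n.
  by apply/seteqP; split => x //= -[->] /eqP; rewrite (negPf on).
set S := stopped_value fn f nu.
have SE x o : nu x = o -> S x = val o x.
  by rewrite /S /stopped_value => ->; case: o.
have mS B o : measurable B -> measurable (S @^-1` B `&` A o).
  move=> mB; rewrite (_ : _ `&` _ = (setT `&` val o @^-1` B) `&` A o).
    by apply: measurableI; [exact: mval|exact: measurable_stopping_level].
  by rewrite setTI; apply/seteqP; split => x /= -[] + nuo; rewrite (SE _ _ nuo).
have GS : Gmeasurable G S.
  apply/GmeasurableP; first exact: Gs.1.
  move=> _ [B mB <-]; rewrite setTI; split.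
    rewrite (_ : _ @^-1` _ = \bigcup_(o in [set: nat]) (S @^-1` B `&` A (onat o))).
      by apply: bigcup_measurable => o _; exact: mS.
    apply/seteqP; split => x; last by move=> [i _ [Sx _]].
    by move=> Sx; exists (oapp succn 0%N (nu x)) => //; split => //; rewrite /A/= onatK.
  move=> n; rewrite (_ : _ `&` _ = (setT `&` fn n @^-1` B) `&` A (Some n)).
    apply: F_setI; last exact: stE.
    have [H _ _] := ffn n; by apply: H; exists B.
  by rewrite setTI; apply/seteqP; split => x /= -[] + nuo; rewrite (SE _ _ nuo).
have mvalA o : Gmeasurable G (val o \_ (A o)).
  apply/GmeasurableP; first exact: Gs.1.
  move=> _ [B mB <-]; split.
    have : measurable_fun setT (val o \_ (A o)).
      by apply/(measurable_restrictT _ (Gs.2 _ (GA o))); exact: measurable_funS (mval o).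
    exact.
  move=> n; have [->|on] := eqVneq o (Some n).
    rewrite [X in F n X](_ : _ = (setT `&` fn n @^-1` B) `&` A (Some n)).
      apply: F_setI; last exact: stE.
      by have [H _ _] := ffn n; apply: H; exists B.
    rewrite !setTI; apply/seteqP; split => x /=.
      by move=> [+ nuo]; rewrite patchE mem_set.
    by move=> [fB nuo]; split => //; rewrite patchE mem_set.
  have [B0|B0] := pselect (B 0).
    rewrite [X in F n X](_ : _ = A (Some n)); first exact: stE.
    apply/seteqP; split => [x [] //|x Ax]; split => //; split => //=.
    by rewrite patchE memNset// => Ao; move: on; rewrite -Ao Ax eqxx.
  rewrite [X in F n X](_ : _ = set0); first by have [[]] := Fs n.
  apply/seteqP; split => [x [[_] /= + Ax]|//].
  by rewrite patchE memNset// => Ao; move: on; rewrite -Ao Ax eqxx.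
have fe := condexpP Gs fi; set e := condexp P G f in fe.
have [_ ei feE] := fe.
have eS o : \forall x \ae P, nu x = o -> e x = S x.
  have vAi : P.-integrable setT (EFin \o (val o \_ (A o))).
    rewrite -restrict_EFin; apply/(integrable_mkcond _ (Gs.2 _ (GA o))).
    by apply: integrableS (vali o) => //; exact: (Gs.2 _ (GA o)).
  have := Gmeasurable_eq_ae Gs (GA o) (is_condexp_meas Gs fe) (mvalA o) ei vAi.
  move=> /(_ _)/wrap[]; last first.
    apply: filterS => x + nuo => /(_ nuo) ->.
    by rewrite patchE mem_set// (SE _ _ nuo).
  move=> B GB BA; rewrite feE//.
  rewrite [RHS](eq_integral (EFin \o val o)); last first.
    by move=> x /set_mem /BA Ax; rewrite /= patchE mem_set.
  case: o BA {mvalA vAi} => [n|] //= BA; have [_ _ ->//] := ffn n.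
  by have [_ /(_ n)] := GB; rewrite setIidl.
have {}eS : \forall x \ae P, e x = S x.
  have := ae_foralln (fun n => eS (onat n)).
  by apply: filterS => x /(_ (oapp succn 0%N (nu x))); rewrite onatK; exact.
have mST := Gmeasurable_measurable Gs GS.
have me := integrable_measurable ei.
have eSA B : measurable B -> (\int[P]_(x in B) (S x)%:E = \int[P]_(x in B) (e x)%:E)%E.
  move=> mB; apply: ae_eq_integral => //.
  - by apply/measurable_EFinP; exact: measurable_funS mST.
  - by apply/measurable_EFinP; exact: measurable_funS me.
  - by apply: filterS eS => x -> _.
split.
- by apply/GmeasurableP => //; exact: Gs.1.
- apply/integrableP; split; first exact/measurable_EFinP.
  case/integrableP : ei => _; apply: le_lt_trans.
  rewrite le_eqVlt; apply/orP; left; apply/eqP; apply: ae_eq_integral => //.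
  + by apply/measurable_EFinP; exact: measurableT_comp.
  + by apply/measurable_EFinP; exact: measurableT_comp.
  + by apply: filterS eS => x /= -> _.
- by move=> B GB; rewrite eSA ?feE//; exact: Gs.2.
Qed.

End stopping.

(** * Maximal inequality and almost everywhere convergence *)

Section first_time.
Context d (T : measurableType d) (R : realType) (P : probability T R).
Variable F : nat -> set (set T).
Hypothesis Fs : forall n, sub_sigma (F n).
Hypothesis Fmono : forall m n, (m <= n)%N -> F m `<=` F n.
Implicit Types (f g h : T -> R) (nu : T -> option nat) (Q : nat -> T -> bool).

Definition first_time (Q : nat -> T -> bool) : T -> option nat := fun x =>
  match pselect (exists n, Q n x) with
  | left ex => Some (ex_minn ex)
  | right _ => None
  end.

Lemma first_time_some Q x n : first_time Q x = Some n ->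
  Q n x /\ forall m, Q m x -> (n <= m)%N.
Proof.
rewrite /first_time; case: pselect => // ex [<-].
by case: ex_minnP.
Qed.

Lemma first_time_none Q x n : first_time Q x = None -> ~~ Q n x.
Proof.
rewrite /first_time; case: pselect => // nex _.
by apply/negP => Qx; apply: nex; exists n.
Qed.

Lemma first_time_stopped Q x n : Q n x -> stopped_set (first_time Q) x.
Proof.
move=> Qx; rewrite /stopped_set/=; apply/eqP => /(first_time_none n).
by rewrite Qx.
Qed.

Lemma first_time_stopping Q : (forall n, F n [set x | Q n x]) ->
  stopping_time F (first_time Q).
Proof.
move=> FQ; apply/(stopping_timeP Fs Fmono) => n.
rewrite (_ : [set x | _] =
    [set x | Q n x] `\` \big[setU/set0]_(m < n) [set x | Q m x]).
  apply: (F_setD Fs) => //.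
  apply: (F_bigsetU Fs (A := fun m => [set x | Q m x])) => m mn.
  by apply: (Fmono (ltnW mn)).
rewrite -(bigcup_mkord _ (fun m => [set x | Q m x])).
apply/seteqP; split => x /=.
  move=> /first_time_some[Qx minn]; split => // -[m /= mn Qm].
  by have := leq_ltn_trans (minn _ Qm) mn; rewrite ltnn.
move=> [Qx H]; case E : (first_time Q x) => [m|]; last first.
  by have := first_time_none n E; rewrite Qx.
have [Qm minm] := first_time_some E; congr Some; apply/eqP.
rewrite eqn_leq minm//= leqNgt; apply/negP => mn; apply: H.
by exists m.
Qed.

Lemma stopped_algebra_stopped nu : stopping_time F nu ->
  stopped_algebra F nu (stopped_set nu).
Proof.
move=> st; split; first exact: measurable_stopped_set.
move=> n; rewrite (_ : _ `&` _ = [set x | nu x = Some n]).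
  by move/(stopping_timeP Fs Fmono) : st.
by apply/seteqP; split => [x []|x /= E] //; rewrite /stopped_set /= E.
Qed.

(** Doob's maximal inequality: h and its stopped value have the same integral
    over {nu < oo}, where the latter is at least the level. *)
Lemma maximal_inequality nu h (hn : nat -> T -> R) (lam : R) :
  stopping_time F nu -> P.-integrable setT (EFin \o h) ->
  (forall n, is_condexp P (F n) h (hn n)) ->
  (forall x n, nu x = Some n -> lam <= hn n x) ->
  (lam%:E * P (stopped_set nu) <= \int[P]_(x in stopped_set nu) (h x)%:E)%E.
Proof.
move=> st hi hnE lamh.
have mB := measurable_stopped_set Fs Fmono st.
have [_ Si SE] := stopped_value_condexp Fs Fmono st hi hnE.
rewrite -SE; last exact: stopped_algebra_stopped.
rewrite -integral_cst//; apply: le_integral => //.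
- exact: finite_measure_integrable_cst.
- exact: integrableS Si.
move=> x /set_mem; rewrite /stopped_set /= lee_fin /stopped_value.
by case E : (nu x) => [n|//] _; exact: lamh.
Qed.

(** A small function has small conditional expectations off a small set,
    simultaneously for all times: the approximation step of the convergence
    theorem. *)
Lemma maximal_exceptional_set u (un : nat -> T -> R) (eta : R) : 0 < eta ->
  P.-integrable setT (EFin \o u) ->
  (forall n, is_condexp P (F n) u (un n)) ->
  exists N, [/\ measurable N,
    (eta%:E * P N <= 3%:E * \int[P]_x `|u x|%:E)%E &
    forall x, ~ N x -> `|u x| <= eta /\ forall n, `|un n x| <= eta].
Proof.
move=> eta0 ui unE.
have main v (vn : nat -> T -> R) : P.-integrable setT (EFin \o v) ->
  (forall n, is_condexp P (F n) v (vn n)) -> exists N, [/\ measurable N,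
    (eta%:E * P N <= \int[P]_x `|v x|%:E)%E &
    forall x, ~ N x -> forall n, vn n x <= eta].
  move=> vi vnE; pose Q n x := eta < vn n x.
  have st : stopping_time F (first_time Q).
    apply: first_time_stopping => n.
    rewrite (_ : [set x | _] = setT `&` vn n @^-1` `]eta, +oo[); last first.
      by apply/seteqP; split => x /=; rewrite in_itv/= andbT// => -[].
    by have [H _ _] := vnE n; apply: H; exists `]eta, +oo[%classic.
  have mB := measurable_stopped_set Fs Fmono st.
  exists (stopped_set (first_time Q)); split => //.
    apply: (le_trans (maximal_inequality st vi vnE _)).
      by move=> x n /first_time_some[/ltW].
    have mv := integrable_measurable vi.
    apply: (@le_trans _ _ (\int[P]_(x in stopped_set (first_time Q)) `|v x|%:E)%E).
      apply: le_integral => //.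
      - exact: integrableS vi.
      - by apply: (integrableS measurableT) => //; exact: integrable_norm.
      - by move=> x _; rewrite lee_fin ler_norm.
    apply: ge0_subset_integral => //.
    by apply/measurable_EFinP; exact: measurableT_comp.
  move=> x nN n; rewrite leNgt; apply/negP => lt; apply: nN.
  exact: (@first_time_stopped Q x n).
have [N1 [mN1 N1u N1P]] := main u un ui unE.
have uNi : P.-integrable setT (EFin \o (fun x => - u x)).
  have := integrableN ui.
  by apply: eq_integrable => // x _ /=; rewrite EFinN.
have [|N2 [mN2 N2u N2P]] := main (fun x => - u x) (fun n x => - un n x) uNi.
  by move=> n; apply: is_condexpN.
have mu := integrable_measurable ui.
pose N3 := [set x | eta%:E <= `|(u x)%:E|]%E.
have mN3 : measurable (setT `&` N3).
  apply: emeasurable_fun_c_infty => //.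
  by apply/measurable_EFinP; exact: measurableT_comp.
rewrite setTI in mN3.
have N3u : (eta%:E * P N3 <= \int[P]_x `|u x|%:E)%E.
  have := @le_integral_abse _ _ _ P setT measurableT (EFin \o u) eta _ eta0.
  by rewrite setTI; apply; exact/measurable_EFinP.
exists (N1 `|` N2 `|` N3); split.
- by apply: measurableU => //; exact: measurableU.
- apply: (@le_trans _ _ (eta%:E * (P N1 + P N2 + P N3))%E).
    apply: lee_wpmul2l; first by rewrite lee_fin ltW.
    apply: (le_trans (measureU2 P (measurableU _ _ mN1 mN2) mN3)).
    by apply: leeD => //; exact: measureU2.
  have I0 : (0 <= \int[P]_x `|u x|%:E)%E by apply: integral_ge0.
  have {}N2u : (eta%:E * P N2 <= \int[P]_x `|u x|%:E)%E.
    by apply: (le_trans N2u); under eq_integral do rewrite normrN.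
  move: I0 N1u N2u N3u; move: (\int[P]_x _)%E => I I0 N1u N2u N3u.
  rewrite !ge0_muleDr ?adde_ge0//.
  rewrite (_ : 3 = 1 + 1 + 1)%R; last by rewrite -addrA.
  rewrite !EFinD !ge0_muleDl ?lee_fin// !mul1e.
  by apply: leeD => //; exact: leeD.
- move=> x /not_orP[/not_orP[n1 n2] n3]; split.
    by apply/ltW; move/negP : n3; rewrite -ltNge lte_fin.
  by move=> n; rewrite ler_norml N1P// andbT lerNl N2P.
Qed.

End first_time.

Section levy.
Context d (T : measurableType d) (R : realType) (P : probability T R).
Variable F : nat -> set (set T).
Hypothesis Fs : forall n, sub_sigma (F n).
Hypothesis Fmono : forall m n, (m <= n)%N -> F m `<=` F n.
Implicit Types (f g h : T -> R).

(** Convergence is asked of all versions at once, which makes the class stable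
    under linear combinations. *)
Definition levy_cv f := P.-integrable setT (EFin \o f) /\
  forall fn : nat -> T -> R, (forall n, is_condexp P (F n) f (fn n)) ->
  \forall x \ae P, fn n x @[n --> \oo] --> f x.

Lemma ae_notin_small (N : nat -> set T) :
  (forall j, measurable (N j)) -> (forall j, P (N j) <= (j.+1%:R^-1)%:E)%E ->
  \forall x \ae P, exists j, ~ N j x.
Proof.
move=> mN Nj; have mI : measurable (\bigcap_j N j) by exact: bigcapT_measurable.
exists (\bigcap_j N j); split => //.
- apply/eqP; rewrite eq_le measure_ge0 andbT; apply/lee_addgt0Pr => e e0.
  rewrite add0e; have [j je] : exists j, j.+1%:R^-1 <= e.
    exists (Num.truncn e^-1); rewrite -[leRHS]invrK lef_pV2 ?posrE ?invr_gt0//.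
    exact/ltW/truncnS_gt.
  apply: (@le_trans _ _ (P (N j))).
    by apply: le_measure; [exact: mem_set|exact: mem_set|move=> x; exact].
  by apply: (le_trans (Nj j)); rewrite lee_fin.
- by move=> x /= H j _; apply: contrapT => nN; apply: H; exists j.
Qed.

(** If g is close to f in L_1, then E_n f - f differs from E_n g - g by terms that
    the maximal inequality makes uniformly small off a small set. *)
Lemma levy_closed f : P.-integrable setT (EFin \o f) ->
  (forall e : R, 0 < e -> exists2 g, levy_cv g &
     (\int[P]_x `|f x - g x|%:E <= e%:E)%E) ->
  levy_cv f.
Proof.
move=> fi H; split => // fn fnE.
suff K (eta : R) : 0 < eta ->
    \forall x \ae P, \forall n \near \oo, `|f x - fn n x| <= 3 * eta.
  have : \forall x \ae P, forall k : nat, \forall n \near \oo,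
      `|f x - fn n x| <= 3 * k.+1%:R^-1.
    by apply: ae_foralln => k; apply: K; rewrite invr_gt0.
  apply: filterS => x Hx; apply/cvgrPdist_le => e e0.
  have [k ke] : exists k, 3 * k.+1%:R^-1 <= e.
    exists (Num.truncn (3 / e)); rewrite ler_pdivrMr// mulrC -ler_pdivrMr//.
    exact/ltW/truncnS_gt.
  by apply: filterS (Hx k) => n /le_trans; apply.
move=> eta0.
(* The L_1 distances are chosen so that the j-th exceptional set has
   probability at most 1/(j+1); almost every point avoids one of them. *)
have /choice[g gP] (j : nat) : exists g, levy_cv g /\
    (\int[P]_x `|f x - g x|%:E <= (eta / 3 / j.+1%:R)%:E)%E.
  have [|g ? ?] := H (eta / 3 / j.+1%:R); first by rewrite !divr_gt0.
  by exists g.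
have /choice[N NP] (j : nat) : exists N, [/\ measurable N,
    (P N <= (j.+1%:R^-1)%:E)%E &
    forall x, ~ N x -> `|f x - g j x| <= eta /\
      forall n, `|fn n x - condexp P (F n) (g j) x| <= eta].
  have [[gi _] gf] := gP j.
  have ui : P.-integrable setT (EFin \o (fun x => -1 * g j x + f x)).
    have := integrableB measurableT fi gi.
    by apply: eq_integrable => // x _ /=; rewrite -EFinB mulN1r addrC.
  have [|N [mN Nu Nx]] := @maximal_exceptional_set _ _ _ P F Fs Fmono _
      (fun n x => -1 * condexp P (F n) (g j) x + fn n x) eta eta0 ui.
    move=> n; apply: is_condexp_linear => //; exact: condexpP.
  exists N; split => //.
    have {}Nu : (eta%:E * P N <= 3%:E * (eta / 3 / j.+1%:R)%:E)%E.
      apply: (le_trans Nu); apply: lee_wpmul2l; first by rewrite lee_fin.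
      apply: le_trans gf; rewrite le_eqVlt; apply/orP; left; apply/eqP.
      by apply: eq_integral => x _; rewrite mulN1r addrC.
    move: Nu; rewrite -(@fineK _ (P N)) ?fin_num_measure// -!EFinM !lee_fin.
    rewrite mulrA (mulrC 3) divfK// ler_pM2l//.
  by move=> x /Nx; rewrite mulN1r addrC => -[-> Hn]; split => // n;
    have := Hn n; rewrite mulN1r addrC.
have A1 : \forall x \ae P, forall j, condexp P (F n) (g j) x @[n --> \oo] --> g j x.
  apply: ae_foralln => j; have [[gi gcv] _] := gP j.
  by apply: gcv => n; exact: condexpP.
have A2 : \forall x \ae P, exists j, ~ N j x.
  by apply: ae_notin_small => j; have [] := NP j.
apply: filterS2 A1 A2 => x A1 [j Njx].
have [_ _ /(_ _ Njx)[fg fgn]] := NP j.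
have /cvgrPdist_le/(_ _ eta0) := A1 j; apply: filterS => n gn.
rewrite (_ : f x - fn n x = (f x - g j x) + (g j x - condexp P (F n) (g j) x) +
  (condexp P (F n) (g j) x - fn n x)); last by rewrite !addrA !subrK.
rewrite (_ : 3 * eta = eta + eta + eta); last by rewrite mulr_natl !mulrS addr0 addrA.
apply: (le_trans (ler_normD _ _)); apply: lerD; last by rewrite distrC.
by apply: (le_trans (ler_normD _ _)); exact: lerD.
Qed.

Lemma levy_linear (a : R) f g : levy_cv f -> levy_cv g ->
  levy_cv (fun x => a * f x + g x).
Proof.
move=> [fi fcv] [gi gcv]; split.
  have := integrableD measurableT (integrableZl measurableT a fi) gi.
  by apply: eq_integrable => // x _ /=; rewrite EFinD EFinM.
move=> hn hnE.
have fE n := condexpP (Fs n) fi; have gE n := condexpP (Fs n) gi.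
have A : \forall x \ae P, forall n,
    hn n x = a * condexp P (F n) f x + condexp P (F n) g x.
  apply: ae_foralln => n; apply: (is_condexp_eq_ae (Fs n) (hnE n)).
  exact: is_condexp_linear.
have {fcv fE} := fcv _ fE; have {gcv gE} := gcv _ gE.
move: A; apply: filterS3 => x A gx fx.
under eq_fun do rewrite A.
by apply: cvgD => //; apply: cvgMr.
Qed.

Lemma levy_Gmeasurable N f : Gmeasurable (F N) f ->
  P.-integrable setT (EFin \o f) -> levy_cv f.
Proof.
move=> mf fi; split => // fn fnE.
have : \forall x \ae P, forall n, (N <= n)%N -> fn n x = f x.
  apply: ae_foralln => n; have [Nn|nN] := leqP N n; last by apply: aeW.
  have : is_condexp P (F n) f f.
    apply: is_condexp_id => //; apply/(GmeasurableP _ (Fs n).1).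
    by apply: subset_trans (Fmono Nn); apply/(GmeasurableP _ (Fs N).1).
  by move=> /(is_condexp_eq_ae (Fs n) (fnE n)); apply: filterS => x.
apply: filterS => x H; apply: cvg_near_cst; by exists N.
Qed.

Hypothesis Fgen : (measurable : set (set T)) = <<s \bigcup_n F n >>.

Lemma indic_integrable (A : set T) : measurable A ->
  P.-integrable setT (EFin \o \1_A).
Proof. by move=> mA; exact: integrable_indic. Qed.

Lemma Gmeasurable_indic N (A : set T) : F N A -> Gmeasurable (F N) (\1_A : T -> R).
Proof.
move=> FA; apply: measurable_indic.
by rewrite (measurable_g_measurableTypeE (Fs N).1).
Qed.

(** The events with convergent indicators form a Dynkin class that contains the
    union of the F n, which is stable under intersection. *)
Lemma levy_indic (A : set T) : measurable A -> levy_cv (\1_A : T -> R).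
Proof.
move=> mA; have : <<s \bigcup_n F n >> A by rewrite -Fgen.
pose D (B : set T) := levy_cv (\1_B : T -> R).
have FD n B : F n B -> D B.
  move=> FB; apply: (@levy_Gmeasurable n); first exact: Gmeasurable_indic.
  by apply: indic_integrable; exact: (Fs n).2.
move: A {mA}; apply: (@dynkin_induction _ _ _ D Fgen).
- move=> B C [n _ FB] [m _ FC]; exists (maxn n m) => //.
  apply: (F_setI Fs).
    by apply: Fmono FB; exact: leq_maxl.
  by apply: Fmono FC; exact: leq_maxr.
- by apply: (FD 0%N); exact: (sub_sigmaT (Fs 0%N)).
- by move=> B [n _ FB]; exact: FD FB.
- move=> B mB DB.
  have DT : D setT by apply: (FD 0%N); exact: (sub_sigmaT (Fs 0%N)).
  have := levy_linear (-1) DB DT; congr levy_cv; apply/funext => x /=.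
  rewrite !indicE in_setC in_setT mulN1r.
  by case: (x \in B); rewrite /= ?oppr0 ?add0r// addNr.
- move=> B mB tB DB.
  pose U K := \big[setU/set0]_(k < K) B k.
  have mU K : measurable (U K) by apply: bigsetU_measurable => *.
  have DU K : D (U K).
    elim: K => [|K IH].
      by rewrite /U big_ord0; apply: (FD 0%N); have [[]] := Fs 0%N.
    have := levy_linear 1 IH (DB K); congr levy_cv; apply/funext => x /=.
    rewrite mul1r /U big_ord_recr /= -/(U K) !indicE in_setU.
    case: (boolP (x \in U K)) => xU; case: (boolP (x \in B K)) => xB;
      rewrite ?addr0 ?add0r//=.
    exfalso; move/set_mem: xU; rewrite /U -bigcup_mkord => -[i /= iK Bi].
    have iK' : i = K by apply: (tB i K I I); exists x; split => //; exact: set_mem.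
    by rewrite iK' ltnn in iK.
  have mBU : measurable (\bigcup_k B k) by exact: bigcup_measurable.
  apply: levy_closed; first exact: indic_integrable.
  move=> e e0.
  have [|||||_ cv0 _] := @dominated_convergence _ _ _ P setT measurableT
      (fun K x => (\1_(U K) x)%:E) (fun x => (\1_(\bigcup_k B k) x)%:E) (cst 1%E).
  + by move=> K; apply/measurable_EFinP.
  + by apply/measurable_EFinP.
  + apply: aeW => x _; apply: cvg_near_cst.
    have [[k _ Bk]|nB] := pselect ((\bigcup_k B k) x).
      exists k.+1 => // K /= kK; rewrite !indicE !mem_set//; first by exists k.
      by rewrite /U -bigcup_mkord; exists k.
    apply: nearW => K; rewrite !indicE !memNset//.
    by rewrite /U -bigcup_mkord => -[k _ Bk]; apply: nB; exists k.
  + exact: finite_measure_integrable_cst.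
  + by apply: aeW => x K _; rewrite lee_fin ger0_norm// indicE; case: (_ \in _).
  have [K HK] := ereal_cvg0_le e0 cv0; exists (\1_(U K)) => //; first exact: DU.
  by apply: le_trans HK; rewrite le_eqVlt; apply/orP; left; apply/eqP;
    apply: eq_integral => x _; rewrite -EFinB distrC.
Qed.

Import HBSimple.

(** Simple functions are dense in L_1, so Levy's upward theorem reduces to
    indicators. *)
Lemma levy_upward f : P.-integrable setT (EFin \o f) -> levy_cv f.
Proof.
move=> fi; apply: levy_closed => // e e0.
have [g [gi _ cv0]] := approximation_sfun_integrable measurableT fi.
have [n Hn] := ereal_cvg0_le e0 cv0; exists (g n); last first.
  by apply: le_trans Hn; rewrite le_eqVlt; apply/orP; left; apply/eqP.
pose s := fset_set (range (g n)).
have -> : (g n : T -> R) = fun x => \sum_(y <- s) y * \1_(g n @^-1` [set y]) x.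
  by apply/funext => x; rewrite fimfunE fsbig_finite.
elim: (enum_fset s) => [|y t IH].
  rewrite (_ : (fun x => _) = cst 0).
    apply: (@levy_Gmeasurable 0%N); first exact: measurable_cst.
    exact: finite_measure_integrable_cst.
  by apply/funext => x; rewrite big_nil.
rewrite (_ : (fun x => _) = fun x => y * \1_(g n @^-1` [set y]) x +
   \sum_(y <- t) y * \1_(g n @^-1` [set y]) x).
  by apply: levy_linear => //; exact: levy_indic.
by apply/funext => x; rewrite big_cons.
Qed.

End levy.

(** * Telescoping along two stopping times *)

Section key.
Context d (T : measurableType d) (R : realType) (P : probability T R).
Variable F : nat -> set (set T).
Hypothesis Fs : forall n, sub_sigma (F n).
Hypothesis Fmono : forall m n, (m <= n)%N -> F m `<=` F n.
Hypothesis Fgen : (measurable : set (set T)) = <<s \bigcup_n F n >>.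
Implicit Types (f g h : T -> R) (nu sigma tau : T -> option nat).

Lemma martingale_of_condexp f : P.-integrable setT (EFin \o f) ->
  forall n, is_condexp P (F n) f (martingale_of P F f n).
Proof. by move=> fi n; exact: condexpP. Qed.

Lemma martingale_of_martingale f : P.-integrable setT (EFin \o f) ->
  martingale P F (martingale_of P F f).
Proof.
move=> fi m n mn; have [a b c] := martingale_of_condexp fi m.
have [_ _ c'] := martingale_of_condexp fi n.
by split => // A FA; rewrite c// c'//; exact: Fmono FA.
Qed.

Definition stop_at f nu := stopped_value (martingale_of P F f) f nu.

Lemma stop_at_condexp f nu : stopping_time F nu ->
  P.-integrable setT (EFin \o f) ->
  is_condexp P (stopped_algebra F nu) f (stop_at f nu).
Proof.
move=> st fi; apply: stopped_value_condexp => //.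
exact: martingale_of_condexp.
Qed.

Lemma stop_at_integrable f nu : stopping_time F nu ->
  P.-integrable setT (EFin \o f) -> P.-integrable setT (EFin \o stop_at f nu).
Proof. by move=> st fi; have [] := stop_at_condexp st fi. Qed.

Lemma tail_integrable f nu : stopping_time F nu ->
  P.-integrable setT (EFin \o f) ->
  P.-integrable setT (fun x => (f x - stop_at f nu x)%:E).
Proof.
move=> st fi; have := integrableB measurableT fi (stop_at_integrable st fi).
by apply: eq_integrable => // x _ /=; rewrite EFinB.
Qed.

Lemma sub_stopped_ae f nu : P.-integrable setT (EFin \o f) ->
  \forall x \ae P, sub_stopped P F f nu x = f x - stop_at f nu x.
Proof.
move=> fi; have [_ /(_ _ (martingale_of_condexp fi))] := levy_upward Fs Fmono Fgen fi.
apply: filterS => x fx; rewrite /sub_stopped /= /limit_fun /stop_at /stopped_value.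
rewrite /stopped; case E : (nu x) => [m|]; last by rewrite !subrr.
congr (_ - _); first exact/cvg_lim.
apply/cvg_lim => //; apply: cvg_near_cst; exists m => // n /= mn.
by rewrite (minn_idPr mn).
Qed.

Lemma stop_at_ae_le h nu (M : R) : stopping_time F nu ->
  measurable_fun setT h -> (forall x, 0 <= h x <= M) ->
  \forall x \ae P, `|stop_at h nu x| <= M.
Proof.
move=> st mh hM; have hi := bounded_integrable P mh hM.
have Gs := stopped_algebra_sub Fs Fmono st.
apply: filterS (is_condexp_bounds Gs hi (stop_at_condexp st hi) hM) => x.
by move=> /andP[h0 hm]; rewrite ger0_norm.
Qed.

Lemma stopped_algebra_le sigma tau : stopping_time F sigma ->
  (forall x n, tau x = Some n -> exists2 m, sigma x = Some m & (m <= n)%N) ->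
  stopping_time F tau ->
  stopped_algebra F sigma `<=` stopped_algebra F tau.
Proof.
move=> st le st' A [mA FA]; split => // n.
rewrite (_ : _ `&` _ = (\big[setU/set0]_(m < n.+1) (A `&` [set x | sigma x = Some (m : nat)]))
  `&` [set x | tau x = Some n]).
  apply: (F_setI Fs); last by move/(stopping_timeP Fs Fmono) : st'.
  apply: (F_bigsetU Fs (A := fun m => A `&` [set x | sigma x = Some m])) => m mn.
  exact: Fmono (FA m).
rewrite -(bigcup_mkord _ (fun m => A `&` [set x | sigma x = Some m])).
apply/seteqP; split => x /= [].
  move=> Ax tx; split => //; have [m sx mn] := le _ _ tx.
  by exists m => //=; rewrite ltnS.
by move=> [m _ [Ax _]].
Qed.

(** Moving from sigma to a later tau costs the pairing of the tail at sigma with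
    the increment of the martingale of h. Expanding the products, the difference
    of the two sides is a combination of three integrals that vanish by
    orthogonality: f - f^sigma against h^sigma, f - f^tau against h^tau, and
    h - h^tau against f^tau - f^sigma. *)
Lemma telescope_step f h sigma tau (M : R) :
  P.-integrable setT (EFin \o f) ->
  measurable_fun setT h -> (forall x, 0 <= h x <= M) ->
  stopping_time F sigma -> stopping_time F tau ->
  (forall x n, tau x = Some n -> exists2 m, sigma x = Some m & (m <= n)%N) ->
  \int[P]_x ((f x - stop_at f sigma x) * h x) =
  \int[P]_x ((f x - stop_at f tau x) * h x) +
  \int[P]_x ((f x - stop_at f sigma x) * (stop_at h tau x - stop_at h sigma x)).
Proof.
move=> fi mh hM ss st sle.
have hi := bounded_integrable P mh hM.
have hs := stop_at_ae_le ss mh hM; have ht := stop_at_ae_le st mh hM.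
have M0 : 0 <= M by have /andP[] := hM point; exact: le_trans.
have hMae : \forall x \ae P, `|h x| <= M.
  by apply: aeW => x; have /andP[h0 hm] := hM x; rewrite ger0_norm.
set fs := stop_at f sigma; set ft := stop_at f tau.
set hs' := stop_at h sigma in hs *; set ht' := stop_at h tau in ht *.
have fsE := stop_at_condexp ss fi; have ftE := stop_at_condexp st fi.
have hsE := stop_at_condexp ss hi; have htE := stop_at_condexp st hi.
have Gs := stopped_algebra_sub Fs Fmono ss.
have Gt := stopped_algebra_sub Fs Fmono st.
have fsi := stop_at_integrable ss fi; have fti := stop_at_integrable st fi.
have mhs := integrable_measurable (stop_at_integrable ss hi).
have mht := integrable_measurable (stop_at_integrable st hi).
have Bi (u v : T -> R) : P.-integrable setT (EFin \o u) ->
    P.-integrable setT (EFin \o v) -> P.-integrable setT (EFin \o (u \- v)).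
  move=> ui vi; have := integrableB measurableT ui vi.
  by apply: eq_integrable => // x _ /=; rewrite EFinB.
have Ms : 0 <= M + M by exact: addr_ge0.
have htsM : \forall x \ae P, `|(ht' \- hs') x| <= M + M.
  apply: filterS2 ht hs => x a b.
  by apply: (le_trans (ler_normB _ _)); exact: lerD.
have hhtM : \forall x \ae P, `|(h \- ht') x| <= M + M.
  apply: filterS2 hMae ht => x a b.
  by apply: (le_trans (ler_normB _ _)); exact: lerD.
have i1 := integrableM_ae M0 (Bi _ _ fi fsi) mh hMae.
have i2 := integrableM_ae M0 (Bi _ _ fi fti) mh hMae.
have i3 := integrableM_ae Ms (Bi _ _ fi fsi) (measurable_funB mht mhs) htsM.
have i4 := integrableM_ae Ms (Bi _ _ fti fsi) (measurable_funB mh mht) hhtM.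
have i5 := integrableM_ae M0 (Bi _ _ fi fti) mht ht.
have i6 := integrableM_ae M0 (Bi _ _ fi fsi) mhs hs.
have o6 := orthogonal_condexp Gs fi fsE (is_condexp_meas Gs hsE) i6.
have o5 := orthogonal_condexp Gt fi ftE (is_condexp_meas Gt htE) i5.
have mY : Gmeasurable (stopped_algebra F tau) (ft \- fs).
  apply: measurable_funB; first exact: is_condexp_meas ftE.
  have [mfs _ _] := fsE; apply/(GmeasurableP _ Gt.1).
  apply: (subset_trans mfs); exact: stopped_algebra_le.
have o4 : (\int[P]_x ((h x - ht' x) * (ft \- fs) x)%:E = 0)%E.
  apply: (orthogonal_condexp Gt hi htE mY).
  by apply: eq_integrable i4 => // x _; rewrite mulrC.
apply/eqP; rewrite addrC -subr_eq.
have R4 : \int[P]_x ((ft x - fs x) * (h x - ht' x)) = 0.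
  rewrite /Rintegral (_ : integral _ _ _ = 0)%E// -[RHS]o4.
  by apply: eq_integral => x _; rewrite mulrC.
have R5 : \int[P]_x ((f x - ft x) * ht' x) = 0 by rewrite /Rintegral o5.
have R6 : \int[P]_x ((f x - fs x) * hs' x) = 0 by rewrite /Rintegral o6.
have i12 := Bi _ _ i1 i2.
have i45 := Bi _ _ i4 i5.
have : \int[P]_x (((ft x - fs x) * (h x - ht' x) - (f x - ft x) * ht' x)
   + (f x - fs x) * hs' x) = 0.
  by rewrite RintegralD// RintegralB// R4 R5 R6 subr0 addr0.
under eq_Rintegral => x _.
  rewrite (_ : _ + _ = ((f x - fs x) * h x - (f x - ft x) * h x) -
    (f x - fs x) * (ht' x - hs' x)); last by ring.
  over.
rewrite RintegralB// RintegralB// => /eqP.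
by rewrite subr_eq0.
Qed.

End key.

(** * Stopping at doubling levels *)

Section level_times.
Context d (T : measurableType d) (R : realType) (P : probability T R).
Variable F : nat -> set (set T).
Hypothesis Fs : forall n, sub_sigma (F n).
Hypothesis Fmono : forall m n, (m <= n)%N -> F m `<=` F n.
Implicit Types (f g h : T -> R) (nu sigma tau : T -> option nat).

Definition reached nu n x : bool :=
  if nu x is Some m then (m <= n)%N else false.

Lemma reached_le nu m n x : (m <= n)%N -> reached nu m x -> reached nu n x.
Proof. by rewrite /reached; case: (nu x) => // k mn /leq_trans; apply. Qed.

Lemma stopping_reached nu n : stopping_time F nu -> F n [set x | reached nu n x].
Proof.
move=> /(_ n); congr (F n); apply/seteqP; split => x /=; rewrite /reached.
  by case: (nu x).
by case: (nu x).
Qed.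

(** Doubling levels; level 0 imposes no condition, so that the sequence starts
    at [nu] itself. *)
Definition above_level nu (hn : nat -> T -> R) (lam : R) i n x : bool :=
  reached nu n x && ((i == 0%N) || (lam * 2 ^+ i < hn n x)).

Definition level_time nu hn lam i : T -> option nat :=
  first_time (above_level nu hn lam i).

Lemma level_time0 nu hn lam : level_time nu hn lam 0 = nu.
Proof.
apply/funext => x; rewrite /level_time.
case E : (first_time _ x) => [n|].
  have [] := first_time_some E; rewrite /above_level /reached andbT.
  case: (nu x) => // m mn minn; congr Some; apply/eqP; rewrite eqn_leq mn.
  by rewrite minn// leqnn.
have := fun n => first_time_none n E; rewrite /above_level /reached.
by case: (nu x) => // m /(_ m); rewrite leqnn.
Qed.

Lemma level_time_stopping nu (hn : nat -> T -> R) lam i : stopping_time F nu ->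
  (forall n, Gmeasurable (F n) (hn n)) ->
  stopping_time F (level_time nu hn lam i).
Proof.
move=> st mh; apply: first_time_stopping => // n.
case: i => [|i].
  rewrite (_ : [set x | _] = [set x | reached nu n x]); first exact: stopping_reached.
  by apply/seteqP; split => x /=; rewrite /above_level andbT.
rewrite (_ : [set x | _] = [set x | reached nu n x] `&`
   (setT `&` hn n @^-1` `]lam * 2 ^+ i.+1, +oo[)); last first.
  apply/seteqP; split => x /=; rewrite /above_level /= in_itv/= andbT.
    by move=> /andP[].
  by move=> [-> [_ ->]].
apply: (F_setI Fs); first exact: stopping_reached.
have /(GmeasurableP _ (Fs n).1) := mh n; apply.
by exists `]lam * 2 ^+ i.+1, +oo[%classic.
Qed.

Lemma above_level_le nu hn (lam : R) i n x : 0 <= lam ->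
  above_level nu hn lam i.+1 n x -> above_level nu hn lam i n x.
Proof.
move=> lam0 /andP[rn /= lt]; rewrite /above_level rn /=.
case: i lt => //= i lt; apply: le_lt_trans lt.
by rewrite ler_wpM2l// ler_weXn2l// ler1n.
Qed.

Lemma level_time_next nu hn (lam : R) i x n : 0 <= lam ->
  level_time nu hn lam i.+1 x = Some n ->
  exists2 m, level_time nu hn lam i x = Some m & (m <= n)%N.
Proof.
move=> lam0 /first_time_some[/(above_level_le lam0) an _].
case E : (level_time nu hn lam i x) => [m|].
  by exists m => //; have [_] := first_time_some E; apply.
by have := first_time_none n E; rewrite an.
Qed.

(** Between two consecutive levels the martingale stays below the upper one,
    except for its last jump, which regularity controls. When the martingale
    already exceeds the upper level at the first time, the two times agree and
    the increment is zero, however large the martingale is. *)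
Lemma level_time_increment nu (hn : nat -> T -> R) h (lam K : R) i x :
  0 <= lam -> 1 <= K -> 0 <= h x -> (forall n, 0 <= hn n x) ->
  (forall n, hn n.+1 x <= K * hn n x) ->
  hn n x @[n --> \oo] --> h x ->
  level_time nu hn lam i x != None ->
  `|stopped_value hn h (level_time nu hn lam i.+1) x -
    stopped_value hn h (level_time nu hn lam i) x| <= K * (lam * 2 ^+ i.+1).
Proof.
move=> lam0 K1 hx0 hn0 hnK hcv; rewrite /stopped_value.
case E : (level_time nu hn lam i x) => [m|//] _.
have [/andP[rm _] minm] := first_time_some E.
set mu := lam * 2 ^+ i.+1.
have mu0 : 0 <= mu by rewrite mulr_ge0// exprn_ge0.
have muK : mu <= K * mu by rewrite ler_peMl.
have diff (a b : R) : 0 <= a <= K * mu -> 0 <= b <= K * mu -> `|a - b| <= K * mu.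
  move=> /andP[a0 aK] /andP[b0 bK]; rewrite ler_norml; apply/andP; split; lra.
have low j : (m <= j)%N -> ~~ above_level nu hn lam i.+1 j x -> hn j x <= mu.
  by move=> mj; rewrite /above_level (reached_le mj rm) /= -leNgt.
case E' : (level_time nu hn lam i.+1 x) => [n|]; last first.
  have lowj j : (m <= j)%N -> hn j x <= mu.
    by move=> mj; apply: low => //; exact: first_time_none.
  apply: diff; last by rewrite hn0 (le_trans _ muK)// lowj.
  rewrite hx0 (le_trans _ muK)//.
  rewrite -(cvg_lim _ hcv)//; apply: limr_le; first by apply/cvg_ex; exists (h x).
  by exists m => // j /= mj; exact: lowj.
have [an minn] := first_time_some E'.
have mn : (m <= n)%N by apply: minm; exact: above_level_le an.
have [->|nm] := eqVneq n m; first by rewrite subrr normr0 mulr_ge0// (le_trans ler01).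
have {nm}mn : (m < n)%N by rewrite ltn_neqAle eq_sym nm.
have lowj j : (m <= j < n)%N -> hn j x <= mu.
  move=> /andP[mj jn]; apply: low => //; apply/negP => /minn.
  by rewrite leqNgt jn.
apply: diff; rewrite hn0 /=; last by rewrite (le_trans _ muK)// lowj// leqnn.
case: n {E' an minn} mn lowj => // n mn lowj.
apply: (le_trans (hnK n)); rewrite ler_wpM2l ?(le_trans ler01)//.
by rewrite lowj// ltnSn andbT -ltnS.
Qed.

End level_times.

(** Regularity of the basis, with the constant exposed: the final constants depend
    on it. *)
Definition jump_bound d (T : measurableType d) (R : realType)
    (P : probability T R) (F : nat -> set (set T)) (K : R) :=
  forall g : nat -> T -> R, martingale P F g ->
    (forall n, \forall x \ae P, 0 <= g n x) ->
    forall n, \forall x \ae P, g n.+1 x <= K * g n x.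

Section key_estimate.
Context d (T : measurableType d) (R : realType) (P : probability T R).
Variable F : nat -> set (set T).
Hypothesis Fs : forall n, sub_sigma (F n).
Hypothesis Fmono : forall m n, (m <= n)%N -> F m `<=` F n.
Hypothesis Fgen : (measurable : set (set T)) = <<s \bigcup_n F n >>.
Implicit Types (f g h : T -> R) (nu sigma tau : T -> option nat).
Variable K : R.
Hypothesis K1 : 1 <= K.
Hypothesis Kreg : jump_bound P F K.

(** Telescoping over the levels. The sum is finite because h is bounded: the
    levels above its bound are never reached, and the last tail vanishes. *)
Lemma key_estimate f h nu (lam M : R) : 0 < lam ->
  P.-integrable setT (EFin \o f) ->
  measurable_fun setT h -> (forall x, 0 <= h x <= M) ->
  stopping_time F nu ->
  exists sigma : nat -> T -> option nat, [/\ sigma 0%N = nu,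
    forall i, stopping_time F (sigma i),
    forall i, ((lam * 2 ^+ i.+1)%:E * P (stopped_set (sigma i.+1)) <=
      \int[P]_(x in stopped_set (sigma i.+1)) (h x)%:E)%E &
    exists I, `|\int[P]_x ((f x - stop_at P F f nu x) * h x)| <=
      \sum_(i < I) K * (lam * 2 ^+ i.+1) *
         \int[P]_x `|f x - stop_at P F f (sigma i) x|].
Proof.
move=> lam0 fi mh hM st.
have hi := bounded_integrable P mh hM.
pose hn := martingale_of P F h.
have hnE : forall n, is_condexp P (F n) h (hn n) := martingale_of_condexp Fs hi.
have hnM : \forall x \ae P, forall n, 0 <= hn n x <= M.
  by apply: ae_foralln => n; exact: is_condexp_bounds (Fs n) hi (hnE n) hM.
have hcv : \forall x \ae P, hn n x @[n --> \oo] --> h x.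
  by have [_] := levy_upward Fs Fmono Fgen hi; apply.
have hreg : \forall x \ae P, forall n, hn n.+1 x <= K * hn n x.
  apply: ae_foralln; apply: Kreg; first exact: martingale_of_martingale.
  by move=> n; apply: filterS hnM => x /(_ n)/andP[].
pose sigma := level_time nu hn lam.
have sst i : stopping_time F (sigma i).
  by apply: level_time_stopping => // n; exact: is_condexp_meas (hnE n).
exists sigma; split => //.
- exact: level_time0.
- move=> i; apply: (maximal_inequality Fs Fmono (sst i.+1) hi hnE).
  by move=> x n /first_time_some[/andP[_ /ltW]].
pose D i := \int[P]_x ((f x - stop_at P F f (sigma i) x) * h x).
pose L i := \int[P]_x `|f x - stop_at P F f (sigma i) x|.
have step i : `|D i| <= `|D i.+1| + K * (lam * 2 ^+ i.+1) * L i.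
  have sle x n : sigma i.+1 x = Some n ->
      exists2 m, sigma i x = Some m & (m <= n)%N.
    by apply: level_time_next; exact: ltW.
  rewrite /D (telescope_step Fs Fmono fi mh hM (sst i) (sst i.+1) sle).
  apply: (le_trans (ler_normD _ _)); rewrite lerD2l.
  set c := K * _.
  have c0 : 0 <= c.
    apply: mulr_ge0; first exact: le_trans K1.
    by apply: mulr_ge0; [exact: ltW|exact: exprn_ge0].
  have ti := tail_integrable Fs Fmono (sst i) fi.
  have mt := integrable_measurable ti.
  pose inc := stop_at P F h (sigma i.+1) \- stop_at P F h (sigma i).
  have minc : measurable_fun setT inc.
    by apply: measurable_funB; apply: integrable_measurable;
      exact: (stop_at_integrable Fs Fmono _ hi).
  have incc : \forall x \ae P, sigma i x != None -> `|inc x| <= c.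
    apply: filterS3 hnM hreg hcv => x hnx hrx hcx sx.
    apply: level_time_increment => //; [exact: ltW| |].
    - by have /andP[] := hM x.
    - by move=> n; have /andP[] := hnx n.
  have ae_le : \forall x \ae P,
     `|(f x - stop_at P F f (sigma i) x) * inc x| <=
     c * `|f x - stop_at P F f (sigma i) x|.
    apply: filterS incc => x incx; rewrite normrM mulrC.
    have [sN|sS] := eqVneq (sigma i x) None; last by rewrite ler_wpM2r// incx.
    by rewrite /stop_at /stopped_value sN subrr normr0 !mulr0.
  rewrite -lee_fin EFin_normr_Rintegral//; last first.
    rewrite (_ : EFin \o _ = fun x =>
      ((f x - stop_at P F f (sigma i) x) * inc x)%:E)//.
    have hs1 := stop_at_ae_le P Fs Fmono (sst i) mh hM.
    have hs2 := stop_at_ae_le P Fs Fmono (sst i.+1) mh hM.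
    have M0 : 0 <= M by have /andP[] := hM point; exact: le_trans.
    apply: (@integrableM_ae _ _ _ _ _ _ (M + M)) => //; first exact: addr_ge0.
    apply: filterS2 hs1 hs2 => x a b.
    by apply: (le_trans (ler_normB _ _)); exact: lerD.
  have mti : measurable_fun setT
      (fun x => ((f x - stop_at P F f (sigma i) x) * inc x)%:E).
    by apply/measurable_EFinP; exact: measurable_funM.
  apply: (le_trans (le_abse_integral _ measurableT mti)).
  apply: (@le_trans _ _ (\int[P]_x (c * `|f x - stop_at P F f (sigma i) x|)%:E)%E).
    apply: ae_ge0_le_integral => //.
    - exact: measurableT_comp.
    - by move=> x _; rewrite lee_fin mulr_ge0.
    - apply/measurable_EFinP; apply: measurable_funM => //.
      exact: measurableT_comp.
    - by apply: filterS ae_le.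
  under eq_integral do rewrite EFinM.
  rewrite ge0_integralZl ?lee_fin//; last first.
    by apply/measurable_EFinP; exact: measurableT_comp.
  have Lfin : (\int[P]_x `|f x - stop_at P F f (sigma i) x|%:E \is a fin_num)%E.
    by rewrite integrable_fin_num//; exact: integrable_norm ti.
  by rewrite -(fineK Lfin) -EFinM lee_fin.
have iter I : `|D 0%N| <= `|D I| + \sum_(i < I) K * (lam * 2 ^+ i.+1) * L i.
  elim: I => [|I IH]; first by rewrite big_ord0 addr0.
  move: IH (step I); rewrite big_ord_recr /=; lra.
have [I IM] : exists I, M <= lam * 2 ^+ I.+1.
  exists (Num.truncn (M / lam)); rewrite mulrC -ler_pdivrMr//.
  apply/ltW; apply: (lt_le_trans (truncnS_gt _)).
  by rewrite -natrX ler_nat ltnW// ltn_expl.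
exists I.+1; have := iter I.+1.
rewrite (_ : D I.+1 = 0) ?normr0 ?add0r.
  by rewrite /D /sigma level_time0.
rewrite /D /Rintegral (ae_eq_integral (cst 0)%E) ?integral0//.
- have mt := integrable_measurable (tail_integrable Fs Fmono (sst I.+1) fi).
  by apply/measurable_EFinP; exact: measurable_funM.
- apply: filterS hnM => x hnx _.
  rewrite /stop_at /stopped_value; case E : (sigma I.+1 x) => [n|].
    have [/andP[_ /= lt] _] := first_time_some E.
    have /andP[_ le] := hnx n.
    by have := lt_le_trans lt (le_trans le IM); rewrite ltxx.
  by rewrite subrr mul0r.
Qed.

End key_estimate.

(** * The local John-Nirenberg estimate *)

Section hoelder_set.
Context d (T : measurableType d) (R : realType) (P : probability T R).

Lemma hoelder_indic (B : set T) (g : T -> R) (p q : R) : measurable B ->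
  measurable_fun setT g -> 0 < p -> 0 < q -> p^-1 + q^-1 = 1 ->
  (\int[P]_(x in B) `|g x|%:E <=
   (fine (P B) `^ p^-1)%:E * 'N[P]_(q%:E)[EFin \o g])%E.
Proof.
move=> mB mg p0 q0 pq.
have m1 : measurable_fun setT (\1_B : T -> R) by exact: measurable_indic.
have := hoelder P m1 mg p0 q0 pq; rewrite Lnorm1.
have -> : ('N[P]_(p%:E)[EFin \o \1_B] = (fine (P B) `^ p^-1)%:E)%E.
  rewrite unlock -poweR_EFin fineK ?fin_num_measure//; congr (_ `^ _)%E.
  rewrite -[X in _ = P X]setIT -(integral_indic P measurableT mB); apply: eq_integral => x _ /=.
  rewrite indicE; case: (_ \in _); rewrite /= ?normr1 ?normr0 ?powR1//.
  by rewrite powR0// gt_eqF.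
congr (_ <= _)%E; rewrite [RHS]integral_mkcond; apply: eq_integral => x _.
rewrite /patch /= indicE; case: (_ \in _); first by rewrite mul1r.
by rewrite mul0r normr0.
Qed.

End hoelder_set.

Section local_estimate.
Context d (T : measurableType d) (R : realType) (P : probability T R).
Variable F : nat -> set (set T).
Hypothesis Fs : forall n, sub_sigma (F n).
Hypothesis Fmono : forall m n, (m <= n)%N -> F m `<=` F n.
Hypothesis Fgen : (measurable : set (set T)) = <<s \bigcup_n F n >>.
Implicit Types (f g h : T -> R) (nu : T -> option nat).
Variable K : R.
Hypothesis K1 : 1 <= K.
Hypothesis Kreg : jump_bound P F K.

Definition tail_norm f nu : R := \int[P]_x `|f x - stop_at P F f nu x|.

Definition trunc_tail f nu (m : R) x : R :=
  Num.min `|f x - stop_at P F f nu x| m.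

Definition stop_prob nu : R := fine (P (stopped_set nu)).

Lemma never_stopping : stopping_time F (fun _ : T => None).
Proof.
move=> n; rewrite (_ : [set x | _] = set0); first by have [[]] := Fs n.
by apply/seteqP; split.
Qed.

Lemma never_stop_prob : stop_prob (fun _ : T => None) = 0.
Proof.
rewrite /stop_prob (_ : stopped_set _ = set0) ?measure0//.
by apply/seteqP; split => x //=; rewrite /stopped_set/= eqxx.
Qed.

Lemma tail_norm_ge0 f nu : 0 <= tail_norm f nu.
Proof. exact: Rintegral_ge0. Qed.

Lemma trunc_tail_bound f nu m x : 0 <= m -> 0 <= trunc_tail f nu m x <= m.
Proof. by move=> m0; rewrite /trunc_tail le_min normr_ge0 m0 ge_min lexx orbT. Qed.

(** The key estimate for h = X^(s-1) on {D >= 0} and on {D < 0}, where D is the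
    tail of f at nu and X the truncation of |D| at m; the truncation makes h
    bounded and all norms of X finite before anything is known on D beyond
    integrability. The family indexed by a boolean serves one sign of D. *)
Lemma local_estimate f nu (s m : R) : 1 < s -> 0 <= m ->
  P.-integrable setT (EFin \o f) -> stopping_time F nu ->
  exists sigma : bool -> nat -> T -> option nat,
    [/\ forall b i, stopping_time F (sigma b i),
        forall b i, stop_prob (sigma b i) `^ (1 - s^-1) <=
           2 ^- i * stop_prob nu `^ (1 - s^-1) &
        ((stop_prob nu `^ (1 - s^-1) *
           (\int[P]_x trunc_tail f nu m x `^ s) `^ s^-1)%:E <=
         (2 * K)%:E * (\esum_(i in [set: nat])
                         (2 ^+ i * tail_norm f (sigma true i))%:E +
                       \esum_(i in [set: nat])
                         (2 ^+ i * tail_norm f (sigma false i))%:E))%E ].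
Proof.
move=> s1 m0 fi st.
have s0 : 0 < s by exact: lt_trans s1.
have sV0 : s^-1 != 0 by rewrite invr_neq0// gt_eqF.
pose a := 1 - s^-1.
have a0 : 0 < a by rewrite /a subr_gt0 invf_lt1.
have aN0 : a != 0 by rewrite gt_eqF.
pose p := stop_prob nu; pose X := trunc_tail f nu m.
have p0 : 0 <= p by exact: fine_ge0.
set y := \int[P]_x (X x `^ s).
have y0 : 0 <= y by apply: Rintegral_ge0 => x _; exact: powR_ge0.
have es0 (r : nat -> R) : (forall i, 0 <= r i) ->
    (0 <= \esum_(i in [set: nat]) (r i)%:E)%E.
  by move=> r0; apply: esum_ge0 => i _; rewrite lee_fin.
have tn0 f' nu' i : 0 <= 2 ^+ i * tail_norm f' nu'.
  by rewrite mulr_ge0 ?exprn_ge0// tail_norm_ge0.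
have K0 : 0 <= K by exact: le_trans K1.
(* If nu is almost surely infinite, or the truncated tail vanishes, the left-hand
   side is 0 and infinite stopping times do. *)
have [py0|] := eqVneq (p * y) 0.
  exists (fun _ _ _ => None); split.
  - by move=> _ _; exact: never_stopping.
  - move=> _ i; rewrite never_stop_prob powR0//.
    by rewrite mulr_ge0 ?powR_ge0// invr_ge0 exprn_ge0.
  - rewrite (_ : _ * _ = 0)%R.
      by rewrite mule_ge0 ?lee_fin ?mulr_ge0// adde_ge0// es0.
    move/eqP: py0; rewrite mulf_eq0 => /orP[|] /eqP; rewrite -/p -/X -/y => ->.
      by rewrite powR0// mul0r.
    by rewrite (@powR0 _ s^-1)// mulr0.
rewrite mulf_eq0 negb_or => /andP[pN0 yN0].
have {pN0}p0' : 0 < p by rewrite lt0r pN0.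
have {yN0}y0' : 0 < y by rewrite lt0r yN0.
(* y is the s-th power of the norm x of X, so lam = x^(s-1) / p^(1-1/s): the level
   at which the maximal inequality returns the probability of nu itself. *)
pose lam := y `^ a / p `^ a.
have pa0 : 0 < p `^ a by exact: powR_gt0.
have ya0 : 0 < y `^ a by exact: powR_gt0.
have lam0 : 0 < lam by exact: divr_gt0.
pose D x := f x - stop_at P F f nu x.
have Di := tail_integrable Fs Fmono st fi.
have mD : measurable_fun setT D := integrable_measurable Di.
have mX : measurable_fun setT X.
  by apply: measurable_minr => //; exact: measurableT_comp.
have X0 x : 0 <= X x by have /andP[] := trunc_tail_bound f nu x m0.
have Xm x : X x <= m by have /andP[] := trunc_tail_bound f nu x m0.
have mXr (r : R) : measurable_fun setT (fun x => X x `^ r).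
  exact: (measurableT_comp (measurable_powR r) mX).
have XrM (r : R) x : 0 <= r -> X x `^ r <= m `^ r.
  by move=> r0; apply: ge0_ler_powR => //; rewrite nnegrE.
have XrI (r : R) : 0 <= r -> P.-integrable setT (fun x => (X x `^ r)%:E).
  move=> r0; apply: (@le_integrable _ _ _ _ _ measurableT _ (EFin \o cst (m `^ r))).
  - exact/measurable_EFinP.
  - by move=> x _; rewrite lee_fin !ger0_norm ?powR_ge0//; exact: XrM.
  - exact: finite_measure_integrable_cst.
have s10 : 0 <= s - 1 by rewrite subr_ge0 ltW.
pose pos b := [set x | if b then 0 <= D x else D x < 0].
pose h b x := X x `^ (s - 1) * \1_(pos b) x.
have mpos b : measurable (pos b).
  case: b; rewrite /pos.
    rewrite (_ : [set x | _] = setT `&` D @^-1` `[0, +oo[); last first.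
      by apply/seteqP; split => x /=; rewrite in_itv/= andbT// => -[].
    exact: mD.
  rewrite (_ : [set x | _] = setT `&` D @^-1` `]-oo, 0[); last first.
    by apply/seteqP; split => x /=; rewrite in_itv/=// => -[].
  exact: mD.
have mh b : measurable_fun setT (h b).
  by apply: measurable_funM => //; exact: measurable_indic.
have ind01 b x : 0 <= (\1_(pos b) x : R) <= 1.
  by rewrite indicE; case: (_ \in _); rewrite /= ?lexx ler01.
have hX b x : 0 <= h b x <= X x `^ (s - 1).
  have /andP[i0 i1] := ind01 b x.
  by rewrite mulr_ge0 ?powR_ge0//= ler_piMr// powR_ge0.
have hM b x : 0 <= h b x <= m `^ (s - 1).
  by have /andP[-> hx] := hX b x; rewrite (le_trans hx)// XrM.
have /choice[sigma sigmaP] (b : bool) := key_estimate Fs Fmono Fgen K1 Kreg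
  lam0 fi (mh b) (hM b) st.
exists sigma; split.
- by move=> b i; have [_ + _ _] := sigmaP b; apply.
(* Maximal inequality, then Hoelder's inequality for h on {sigma b i < oo}. *)
- move=> b [|i]; have [sig0 sst sP _] := sigmaP b.
    by rewrite sig0 expr0 invr1 mul1r.
  have mB := measurable_stopped_set Fs Fmono (sst i.+1).
  set B := stopped_set _ in mB.
  have hi : P.-integrable setT (EFin \o h b).
    apply: le_integrable (XrI _ s10) => //; first exact/measurable_EFinP.
    by move=> x _; have /andP[? ?] := hX b x; rewrite lee_fin !ger0_norm ?powR_ge0.
  have q0 : 0 < a^-1 by rewrite invr_gt0.
  have pq : s^-1 + a^-1^-1 = 1 by rewrite invrK /a addrC subrK.
  have := hoelder_indic P mB (mXr (s - 1)) s0 q0 pq.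
  have -> : ('N[P]_(a^-1%:E)[EFin \o (fun x => X x `^ (s - 1))%R] = (y `^ a)%:E)%E.
    rewrite unlock invrK -poweR_EFin; congr (_ `^ _)%E.
    rewrite /y /Rintegral fineK; last by rewrite integrable_fin_num// XrI// ltW.
    apply: eq_integral => x _ /=; rewrite ger0_norm ?powR_ge0// -powRrM.
    congr (_ `^ _)%:E; rewrite /a; field.
    by rewrite gt_eqF//= subr_eq0 gt_eqF.
  move=> hol; pose beta := stop_prob (sigma b i.+1).
  have beta0 : 0 <= beta by exact: fine_ge0.
  have PB : P B = beta%:E by rewrite fineK ?fin_num_measure.
  have bnd : lam * 2 ^+ i.+1 * beta <= beta `^ s^-1 * y `^ a.
    rewrite -lee_fin EFinM -PB; apply: (le_trans (sP i)); apply: le_trans hol.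
    apply: le_integral => //.
    - exact: integrableS hi.
    - apply: (integrableS measurableT) => //; apply: integrable_norm.
      exact: XrI.
    - move=> x _; have /andP[? ?] := hX b x.
      by rewrite lee_fin ger0_norm ?powR_ge0.
  rewrite -/beta -/a -/p.
  have [b0|bN0] := eqVneq beta 0.
    by rewrite b0 powR0// mulr_ge0 ?powR_ge0// invr_ge0 exprn_ge0.
  have bg0 : 0 < beta by rewrite lt0r bN0.
  have bs0 : 0 < beta `^ s^-1 by exact: powR_gt0.
  have bE : beta = beta `^ a * beta `^ s^-1.
    rewrite -powRD; last by rewrite bN0 implybT.
    by rewrite /a subrK powRr1.
  rewrite ler_pdivlMl ?exprn_gt0//.
  rewrite -(ler_pM2r (mulr_gt0 ya0 bs0)).
  have e1 : lam * 2 ^+ i.+1 * beta * p `^ a =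
      2 ^+ i.+1 * beta `^ a * (y `^ a * beta `^ s^-1).
    by rewrite {1}bE /lam; field; rewrite gt_eqF.
  have e2 : beta `^ s^-1 * y `^ a * p `^ a = p `^ a * (y `^ a * beta `^ s^-1) by ring.
  by rewrite -e1 -e2 ler_pM2r.
- pose E b := (\esum_(i in [set: nat]) (2 ^+ i * tail_norm f (sigma b i))%:E)%E.
  have hDi b : P.-integrable setT (fun x => (D x * h b x)%:E).
    apply: (integrableM_ae (M := m `^ (s - 1))) => //; first exact: powR_ge0.
    by apply: aeW => x; have /andP[? ?] := hM b x; rewrite ger0_norm.
  have bound b : ((`|\int[P]_x (D x * h b x)|)%:E <= (2 * K * lam)%:E * E b)%E.
    have [_ _ _ [I HI]] := sigmaP b.
    have c0 : 0 <= 2 * K * lam by apply: mulr_ge0; [exact: mulr_ge0|exact: ltW].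
    have H := le_sum_esum I (fun i => tn0 f (sigma b i) i).
    apply: le_trans (lee_wpmul2l _ H); last by rewrite lee_fin.
    rewrite -EFinM lee_fin; apply: (le_trans HI).
    rewrite mulr_sumr; apply: ler_sum => i _; rewrite exprS /tail_norm.
    by rewrite le_eqVlt; apply/orP; left; apply/eqP; ring.
  (* X^s = X X^(s-1) <= |D| X^(s-1), and the two signs of D separate. *)
  have yD : y <= `|\int[P]_x (D x * h true x)| + `|\int[P]_x (D x * h false x)|.
    apply: (@le_trans _ _
        (\int[P]_x (D x * h true x) - \int[P]_x (D x * h false x))).
      rewrite -(RintegralB measurableT (hDi true) (hDi false)) /y; apply: le_Rintegral => //.
      - by apply: XrI; exact: ltW.
      - have := integrableB measurableT (hDi true) (hDi false).
        by apply: eq_integrable => // x _ /=; rewrite EFinB.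
      move=> x _; rewrite -mulr_powRB1//.
      rewrite (_ : D x * h true x - D x * h false x = `|D x| * X x `^ (s - 1)).
        by rewrite ler_wpM2r ?powR_ge0// /X /trunc_tail ge_min lexx.
      rewrite /h !indicE /pos; case: (leP 0 (D x)) => Dx.
        rewrite mem_set// memNset; last by rewrite /= ltNge Dx.
        by rewrite mulr1 !mulr0 subr0 ger0_norm.
      rewrite memNset; last by rewrite /= leNgt Dx.
      by rewrite mem_set// mulr1 !mulr0 sub0r ltr0_norm// mulNr.
    by apply: lerD; [exact: ler_norm|rewrite -normrN ler_norm].
  have yE : (y%:E <= (2 * K * lam)%:E * (E true + E false))%E.
    have E0 b : (0 <= E b)%E by apply: es0 => i; exact: tn0.
    rewrite ge0_muleDr//; apply: le_trans (leeD (bound true) (bound false)).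
    by rewrite -EFinD lee_fin.
  rewrite -/a -/p -/X -/y.
  have -> : p `^ a * y `^ s^-1 = lam^-1 * y.
    have {2}-> : y = y `^ a * y `^ s^-1.
      rewrite -powRD; last by rewrite (gt_eqF y0') implybT.
      by rewrite /a subrK powRr1.
    by rewrite /lam; field; rewrite !gt_eqF.
  rewrite EFinM; apply: (@le_trans _ _ (lam^-1%:E * ((2 * K * lam)%:E * (E true + E false)))%E).
    by apply: lee_wpmul2l => //; rewrite lee_fin invr_ge0 ltW.
  rewrite muleA -EFinM (_ : lam^-1 * (2 * K * lam) = 2 * K)//.
  by field; rewrite gt_eqF.
Qed.

End local_estimate.

(** * Comparison of the norms *)

Section bmo_ratio.
Context d (T : measurableType d) (R : realType) (P : probability T R).
Variable F : nat -> set (set T).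
Implicit Types (f : T -> R) (nu : int -> T -> option nat).
Local Open Scope ereal_scope.

Definition BMO_num (r : R) f nu : \bar R :=
  \esum_(k in [set: int])
      (2 ^ k * fine (P (stopped_set (nu k))) `^ (1 - r^-1))%R%:E
      * 'N[P]_(r%:E)[EFin \o sub_stopped P F f (nu k)].

Lemma BMO_num_ge0 r f nu : 0 <= BMO_num r f nu.
Proof.
apply: esum_ge0 => k _; apply: mule_ge0; last exact: Lnorm_ge0.
by rewrite lee_fin mulr_ge0 ?powR_ge0// exprz_ge0.
Qed.

(** When the weights are all zero the ratio is the numerator times +oo, so a
    finite norm forces the numerator to vanish. *)
Lemma BMO_num_le r q alpha f nu : BMO_norm P F r q alpha f < +oo ->
  BMO_admissible P F q alpha nu ->
  BMO_num r f nu <= BMO_norm P F r q alpha f * lq_norm q (BMO_weight P alpha nu).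
Proof.
move=> N1 adm; have : BMO_ratio P F r q alpha f nu <= BMO_norm P F r q alpha f.
  by apply: ereal_sup_ubound; exists nu.
have [_] := adm; rewrite /BMO_ratio -/(BMO_num r f nu).
have := lq_norm_ge0 q (BMO_weight P alpha nu); have := BMO_num_ge0 r f nu.
move: (BMO_num r f nu) (lq_norm q _) (BMO_norm _ _ _ _ _ _) N1 => n l N Ny n0.
case: l => [l| |]// l0 _; rewrite lee_fin in l0.
have [->|lN0] := eqVneq l 0%R; last first.
  have lp : (0 < l)%R by rewrite lt0r lN0.
  by rewrite inver (negPf lN0) lee_pdivrMr.
rewrite inver eqxx mule0; have [->//|nN0] := eqVneq n 0.
rewrite gt0_muley; last by rewrite lt0e nN0.
by rewrite leye_eq => /eqP Ny'; rewrite Ny' in Ny.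
Qed.

Lemma BMO_ratio_le r q alpha f nu (c : \bar R) : 0 <= c ->
  BMO_admissible P F q alpha nu ->
  BMO_num r f nu <= c * lq_norm q (BMO_weight P alpha nu) ->
  BMO_ratio P F r q alpha f nu <= c.
Proof.
move=> c0 [_]; rewrite /BMO_ratio -/(BMO_num r f nu).
have := lq_norm_ge0 q (BMO_weight P alpha nu); have := BMO_num_ge0 r f nu.
move: (BMO_num r f nu) (lq_norm q _) => n l n0.
case: l => [l| |]// l0 _; rewrite lee_fin in l0.
have [->|lN0] := eqVneq l 0%R; last first.
  have lp : (0 < l)%R by rewrite lt0r lN0.
  by rewrite inver (negPf lN0) lee_pdivrMr.
rewrite mule0 => nle0; have -> : n = 0 by apply/eqP; rewrite eq_le nle0.
by rewrite mul0e.
Qed.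

Lemma BMO_norm_ge0 r q alpha f : (forall n, sub_sigma (F n)) -> (0 < q)%R ->
  (0 <= alpha)%R -> 0 <= BMO_norm P F r q alpha f.
Proof.
move=> Fs q0 a0; pose nu (_ : int) (_ : T) : option nat := None.
have adm : BMO_admissible P F q alpha nu.
  split; first by move=> k; exact: never_stopping.
  have B0 k : BMO_weight P alpha nu k = 0%R.
    rewrite /BMO_weight -/(stop_prob P (nu k)) never_stop_prob powR0 ?mulr0//.
    by rewrite gt_eqF// ltr_pwDl.
  rewrite /lq_norm esum1 ?poweR0r ?invr_neq0 ?gt_eqF//.
  by move=> k _; rewrite B0 normr0 powR0// gt_eqF.
apply: (@le_trans _ _ (BMO_ratio P F r q alpha f nu)).
  apply: mule_ge0; first exact: BMO_num_ge0.
  exact/inve_ge0/lq_norm_ge0.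
by apply: ereal_sup_ubound; exists nu.
Qed.

End bmo_ratio.

Section bmo.
Context d (T : measurableType d) (R : realType) (P : probability T R).
Variable F : nat -> set (set T).
Hypothesis Pcomplete : measure_is_complete P.
Hypothesis Fs : forall n, sub_sigma (F n).
Hypothesis Fmono : forall m n, (m <= n)%N -> F m `<=` F n.
Hypothesis Fgen : (measurable : set (set T)) = <<s \bigcup_n F n >>.
Variables (q alpha : R).
Hypothesis q0 : 0 < q.
Hypothesis alpha0 : 0 <= alpha.
Implicit Types (f : T -> R).

(** Completeness provides the measurability of v, here the pointwise limits in
    the definition of f - f^nu. *)
Lemma Lnorm_ae_eq (r : R) (u v : T -> R) : 0 < r -> measurable_fun setT u ->
  (\forall x \ae P, v x = u x) ->
  ('N[P]_(r%:E)[EFin \o v] = 'N[P]_(r%:E)[EFin \o u])%E.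
Proof.
move=> r0 mu vu.
have mv : measurable_fun setT v.
  apply/measurable_EFinP; apply: (ae_measurable_fun Pcomplete (f := EFin \o u)).
    by apply: filterS vu => x /= ->.
  exact/measurable_EFinP.
have mr (w : T -> R) : measurable_fun setT w ->
    measurable_fun setT (fun x => (`|w x| `^ r)%:E).
  move=> mw; apply/measurable_EFinP.
  by apply: (measurableT_comp (measurable_powR r)); exact: measurableT_comp.
rewrite unlock; apply: (f_equal (fun z => poweR z r^-1)).
apply: ae_eq_integral => //.
- exact: mr.
- exact: mr.
- by apply: filterS vu => x /= ->.
Qed.

Lemma Lnorm_sub_stopped (r : R) f (nu : T -> option nat) : 0 < r ->
  P.-integrable setT (EFin \o f) -> stopping_time F nu ->
  ('N[P]_(r%:E)[EFin \o sub_stopped P F f nu] =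
   'N[P]_(r%:E)[EFin \o (fun x => f x - stop_at P F f nu x)%R])%E.
Proof.
move=> r0 fi st; apply: Lnorm_ae_eq => //.
  exact: (integrable_measurable (tail_integrable Fs Fmono st fi)).
exact: sub_stopped_ae.
Qed.

Lemma Lnorm1_sub_stopped f (nu : T -> option nat) :
  P.-integrable setT (EFin \o f) -> stopping_time F nu ->
  ('N[P]_(1%:E)[EFin \o sub_stopped P F f nu] = (tail_norm P F f nu)%:E)%E.
Proof.
move=> fi st; rewrite Lnorm_sub_stopped// Lnorm1 /tail_norm /Rintegral fineK//.
rewrite integrable_fin_num//.
exact: integrable_norm (tail_integrable Fs Fmono st fi).
Qed.

(** The tail vanishes where the stopping time is infinite, so Hoelder's inequality
    on the complement bounds its L_1 norm. *)
Lemma BMO_norm1_le_norm (r : R) f : 1 <= r -> P.-integrable setT (EFin \o f) ->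
  (BMO_norm P F 1 q alpha f <= BMO_norm P F r q alpha f)%E.
Proof.
rewrite le_eqVlt => /predU1P[<-//|r1 fi].
have r0 : 0 < r by exact: lt_trans r1.
apply: ge_ereal_sup => _ [nu adm <-].
apply: (@le_trans _ _ (BMO_ratio P F r q alpha f nu)); last first.
  by apply: ereal_sup_ubound; exists nu.
apply: lee_wpmul2r; first exact/inve_ge0/lq_norm_ge0.
apply: le_esum => k _; have stk := adm.1 k.
rewrite !EFinM -!muleA; apply: lee_wpmul2l; first by rewrite lee_fin exprz_ge0.
rewrite invr1 subrr powRr0 mul1e Lnorm1_sub_stopped// Lnorm_sub_stopped//.
have ti := tail_integrable Fs Fmono stk fi.
have mB := measurable_stopped_set Fs Fmono stk.
have a0 : 0 < 1 - r^-1 by rewrite subr_gt0 invf_lt1.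
have pq : (1 - r^-1)^-1^-1 + r^-1 = 1 by rewrite invrK subrK.
have a0' : 0 < (1 - r^-1)^-1 by rewrite invr_gt0.
have := hoelder_indic P mB (integrable_measurable ti) a0' r0 pq.
rewrite invrK; apply: le_trans.
rewrite /tail_norm /Rintegral fineK; last first.
  by rewrite integrable_fin_num//; exact: integrable_norm ti.
rewrite [leRHS]integral_mkcond le_eqVlt; apply/orP; left; apply/eqP.
apply: eq_integral => x _; rewrite /patch; case: ifPn => // /negP xB.
rewrite /stop_at /stopped_value; case E : (nu k x) => [n|].
  by exfalso; apply: xB; apply: mem_set; rewrite /stopped_set /= E.
by rewrite subrr normr0.
Qed.

Variable K : R.
Hypothesis K1 : 1 <= K.
Hypothesis Kreg : jump_bound P F K.

Section exponent.
Variable s : R.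
Hypothesis s1 : 1 < s.

Let a : R := 1 - s^-1.

Let s0 : 0 < s. Proof. exact: lt_trans s1. Qed.

Let a0 : 0 < a. Proof. by rewrite subr_gt0 invf_lt1. Qed.

Let a1 : a < 1. Proof. by rewrite /a ltrBlDr ltrDl invr_gt0. Qed.

(** A gain of a factor 2 at the power 1 - 1/s < 1 is a gain of more than a factor
    2 in probability, which beats the weights 2 ^ i of the key estimate. *)
Definition decay : R := 2^-1 `^ a^-1.

Let decay_gt0 : 0 < decay. Proof. by rewrite powR_gt0. Qed.

Lemma decay_lt : 0 < 2 * decay < 1.
Proof.
rewrite mulr_gt0//=; have a1V : 1 < a^-1 by rewrite invf_gt1.
rewrite /decay -mulr_powRB1 ?invr_gt0// mulrA divff// mul1r.
rewrite lt_neqAle powR_eq1 -[X in _ <= X](powRr0 2^-1) ger_powR; last 2 first.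
- by rewrite invr_gt0 invf_le1//= ltr0n ler1n.
- by rewrite subr_ge0 ltW.
rewrite andbT !negb_or -leNgt invr_ge0 ler0n subr_eq0 (gt_eqF a1V) andbT.
by rewrite invr_eq1 (eqr_nat R 2 1).
Qed.

Lemma weight_decay (p b : R) i : 0 <= p -> 0 <= b ->
  b `^ a <= 2 ^- i * p `^ a ->
  b `^ (1 + alpha) <= decay ^+ i * p `^ (1 + alpha).
Proof.
move=> p0 b0 H; have aN0 : a != 0 by rewrite gt_eqF.
have c0 : 0 <= (1 + alpha) / a by apply: divr_ge0; [exact: addr_ge0|exact: ltW].
have E (z : R) : z `^ (1 + alpha) = (z `^ a) `^ ((1 + alpha) / a).
  by rewrite -powRrM mulrC divfK.
rewrite !E; apply: (@le_trans _ _ ((2 ^- i * p `^ a) `^ ((1 + alpha) / a))).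
  apply: ge0_ler_powR => //; rewrite nnegrE ?powR_ge0//.
  by rewrite mulr_ge0 ?powR_ge0// invr_ge0 exprn_ge0.
rewrite powRM ?powR_ge0 ?invr_ge0 ?exprn_ge0//.
apply: ler_wpM2r; first exact: powR_ge0.
have -> : decay ^+ i = (2 ^- i) `^ a^-1.
  rewrite /decay -powR_mulrn ?powR_ge0// -!powRrM [a^-1 * _]mulrC powRrM.
  by rewrite powR_mulrn// exprVn.
apply: ger_powR.
  by rewrite invr_gt0 exprn_gt0//= invf_le1 ?exprn_gt0// exprn_ege1// ler1n.
by rewrite ler_peMl ?invr_ge0 ?(ltW a0)// lerDl.
Qed.

(** After exchanging the sums, each i contributes the numerator of the ratio, at
    the exponent 1, of the sequence k |-> sigma k i; its weights are those of nu
    scaled by decay ^ i. *)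
Lemma family_bound f (nu : int -> T -> option nat)
    (sigma : int -> nat -> T -> option nat) :
  P.-integrable setT (EFin \o f) ->
  (BMO_norm P F 1 q alpha f < +oo)%E -> BMO_admissible P F q alpha nu ->
  (forall k i, stopping_time F (sigma k i)) ->
  (forall k i, stop_prob P (sigma k i) `^ a <= 2 ^- i * stop_prob P (nu k) `^ a) ->
  (\esum_(k in [set: int]) ((2 ^ k)%:E *
     \esum_(i in [set: nat]) (2 ^+ i * tail_norm P F f (sigma k i))%:E) <=
   ((1 - 2 * decay)^-1)%:E *
     (BMO_norm P F 1 q alpha f * lq_norm q (BMO_weight P alpha nu)))%E.
Proof.
move=> fi N1 adm sst sP.
set N := BMO_norm _ _ _ _ _ _ in N1 *; set l := lq_norm _ _.
have N0 : (0 <= N)%E by exact: BMO_norm_ge0.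
have l0 : (0 <= l)%E by exact: lq_norm_ge0.
have tn0 k i : 0 <= tail_norm P F f (sigma k i) by exact: tail_norm_ge0.
have k0 k : 0 < 2 ^ k :> R by rewrite exprz_gt0.
under eq_esum => k _.
  rewrite -esumZ//; last by move=> i; rewrite lee_fin mulr_ge0 ?exprn_ge0.
  under eq_esum => i _ do rewrite EFinM muleCA.
  over.
rewrite esum_swap; last first.
  by move=> k i; rewrite !mule_ge0 ?lee_fin ?exprn_ge0// ltW.
apply: le_trans (esum_geometric_le decay_lt _); last exact: mule_ge0.
apply: le_esum => i _; rewrite exprMn EFinM -muleA.
rewrite esumZ ?exprn_gt0//; last first.
  by move=> k; rewrite mule_ge0 ?lee_fin// ltW.
apply: lee_wpmul2l; first by rewrite lee_fin exprn_ge0.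
pose si k := sigma k i.
have lqi : (lq_norm q (BMO_weight P alpha si) <= (decay ^+ i)%:E * l)%E.
  apply: lq_norm_scale => //; first by rewrite exprn_gt0.
    by move=> k; rewrite mulr_ge0 ?powR_ge0// ltW.
  move=> k; rewrite /BMO_weight mulrCA ler_pM2l//.
  by apply: weight_decay; [exact: fine_ge0|exact: fine_ge0|exact: sP].
have admi : BMO_admissible P F q alpha si.
  split=> [k|]; first exact: sst.
  apply: (le_lt_trans lqi); have [_] := adm; rewrite -/l.
  by case: l l0 {lqi} => [l| |]// _ _; rewrite -EFinM ltry.
have := BMO_num_le N1 admi; rewrite -/N => H.
apply: (@le_trans _ _ (BMO_num P F 1 f si)).
  rewrite /BMO_num; apply: le_esum => k _.
  by rewrite invr1 subrr powRr0 mulr1 (Lnorm1_sub_stopped fi (sst k i)).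
apply: (le_trans H); apply: (le_trans (lee_wpmul2l N0 lqi)).
by rewrite (muleCA N (decay ^+ i)%:E l).
Qed.

Definition BMO_const : R := 4 * K / (1 - 2 * decay).

Lemma BMO_const_gt0 : 0 < BMO_const.
Proof.
have /andP[_ ?] := decay_lt.
by rewrite divr_gt0 ?subr_gt0// mulr_gt0// (lt_le_trans ltr01).
Qed.

Lemma truncated_bound f (nu : int -> T -> option nat) (m : R) : 0 <= m ->
  P.-integrable setT (EFin \o f) ->
  (BMO_norm P F 1 q alpha f < +oo)%E -> BMO_admissible P F q alpha nu ->
  (\esum_(k in [set: int]) (2 ^ k * stop_prob P (nu k) `^ a *
     (\int[P]_x trunc_tail P F f (nu k) m x `^ s) `^ s^-1)%:E <=
   BMO_const%:E *
     (BMO_norm P F 1 q alpha f * lq_norm q (BMO_weight P alpha nu)))%E.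
Proof.
move=> m0 fi N1 adm.
have /choice[sigma sigmaP] k := local_estimate Fs Fmono Fgen K1 Kreg s1 m0 fi (adm.1 k).
set W := (BMO_norm _ _ _ _ _ _ * _)%E.
have k0 k : 0 < 2 ^ k :> R by rewrite exprz_gt0.
have K0 : 0 < K by exact: lt_le_trans K1.
pose E b k := (\esum_(i in [set: nat]) (2 ^+ i * tail_norm P F f (sigma k b i))%:E)%E.
have E0 b k : (0 <= E b k)%E.
  by apply: esum_ge0 => i _; rewrite lee_fin mulr_ge0 ?exprn_ge0 ?tail_norm_ge0.
have kE0 b k : (0 <= (2 ^ k)%:E * E b k)%E by rewrite mule_ge0 ?lee_fin// ltW.
have bound b : (\esum_(k in [set: int]) ((2 ^ k)%:E * E b k) <=
    ((1 - 2 * decay)^-1)%:E * W)%E.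
  apply: (family_bound (sigma := fun k => sigma k b)) => // k i.
    by have [H _ _] := sigmaP k.
  by have [_ H _] := sigmaP k; exact: H.
apply: (@le_trans _ _ (\esum_(k in [set: int]) ((2 * K)%:E *
    ((2 ^ k)%:E * E true k + (2 ^ k)%:E * E false k)))%E).
  apply: le_esum => k _; have [_ _ H] := sigmaP k.
  rewrite -ge0_muleDr// muleCA -mulrA EFinM; apply: lee_wpmul2l => //.
  by rewrite lee_fin ltW.
rewrite esumZ ?mulr_gt0//; last by move=> k; rewrite adde_ge0.
rewrite esumD//; apply: (@le_trans _ _ ((2 * K)%:E *
    (((1 - 2 * decay)^-1)%:E * W + ((1 - 2 * decay)^-1)%:E * W))%E).
  by apply: lee_wpmul2l; [rewrite lee_fin mulr_ge0// ltW|exact: leeD].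
have W0 : (0 <= W)%E.
  by apply: mule_ge0; [exact: BMO_norm_ge0|exact: lq_norm_ge0].
have /andP[_ dlt] := decay_lt.
have d0 : 0 <= (1 - 2 * decay)^-1 by rewrite invr_ge0 subr_ge0 ltW.
have -> : BMO_const = 2 * K * ((1 - 2 * decay)^-1 + (1 - 2 * decay)^-1).
  by rewrite /BMO_const; field; rewrite gt_eqF// subr_gt0.
by rewrite -ge0_muleDl ?lee_fin// muleA -EFinD -EFinM.
Qed.


Lemma trunc_tail_integrable f (nu : T -> option nat) (m : R) : 0 <= m ->
  P.-integrable setT (EFin \o f) -> stopping_time F nu ->
  P.-integrable setT (fun x => (trunc_tail P F f nu m x `^ s)%:E).
Proof.
move=> m0 fi st.
have mD := integrable_measurable (tail_integrable Fs Fmono st fi).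
apply: (@le_integrable _ _ _ _ _ measurableT _ (EFin \o cst (m `^ s))).
- apply/measurable_EFinP; apply: (measurableT_comp (measurable_powR s)).
  by apply: measurable_minr => //; exact: measurableT_comp.
- move=> x _; have /andP[x0 xm] := trunc_tail_bound P F f nu x m0.
  rewrite lee_fin !ger0_norm ?powR_ge0//.
  by apply: ge0_ler_powR; rewrite ?nnegrE ?(ltW s0).
- exact: finite_measure_integrable_cst.
Qed.

Lemma trunc_tail_homo f (nu : T -> option nat) x (m n : R) : 0 <= m -> m <= n ->
  trunc_tail P F f nu m x `^ s <= trunc_tail P F f nu n x `^ s.
Proof.
move=> m0 mn; have /andP[x0 _] := trunc_tail_bound P F f nu x m0.
have /andP[x0' _] := trunc_tail_bound P F f nu x (le_trans m0 mn).
by apply: ge0_ler_powR; rewrite ?nnegrE ?(ltW s0)// /trunc_tail le_min2.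
Qed.

Lemma Lnorm_trunc_sup f (nu : T -> option nat) :
  P.-integrable setT (EFin \o f) -> stopping_time F nu ->
  ('N[P]_(s%:E)[EFin \o (fun x => f x - stop_at P F f nu x)%R] <=
   ereal_sup (range (fun m : nat =>
     ((\int[P]_x trunc_tail P F f nu m%:R x `^ s) `^ s^-1)%:E)))%E.
Proof.
move=> fi st; set S := ereal_sup _.
pose X (m : nat) x := trunc_tail P F f nu m%:R x.
pose D x := f x - stop_at P F f nu x.
have XI m : P.-integrable setT (fun x => (X m x `^ s)%:E).
  exact: trunc_tail_integrable.
have mXs m : measurable_fun setT (fun x => (X m x `^ s)%:E).
  exact: measurable_int (XI m).
have S0 : (0 <= S)%E.
  apply: (@le_trans _ _ ((\int[P]_x X 0%N x `^ s) `^ s^-1)%:E).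
    by rewrite lee_fin powR_ge0.
  by apply: ereal_sup_ubound; exists 0%N.
have XS m : (\int[P]_x (X m x `^ s)%:E <= S `^ s)%E.
  have -> : (\int[P]_x (X m x `^ s)%:E =
      ((\int[P]_x X m x `^ s) `^ s^-1)%:E `^ s)%E.
    rewrite poweR_EFin -powRrM mulVf ?gt_eqF// powRr1.
      by rewrite /Rintegral fineK// integrable_fin_num.
    by apply: Rintegral_ge0 => x _; exact: powR_ge0.
  apply: le_poweR; [exact: ltW|by rewrite lee_fin powR_ge0|].
  by apply: ereal_sup_ubound; exists m.
have DS : (\int[P]_x (`|D x| `^ s)%:E <= S `^ s)%E.
  have Xnd x : {homo (fun m => (X m x `^ s)%:E) : n m / (n <= m)%N >-> (n <= m)%E}.
    by move=> n m nm; rewrite lee_fin; apply: trunc_tail_homo; rewrite ?ler_nat.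
  have -> : (\int[P]_x (`|D x| `^ s)%:E =
      \int[P]_x limn (fun m => (X m x `^ s)%:E))%E.
    apply: eq_integral => x _; apply/esym/cvg_lim => //; apply: cvg_near_cst.
    exists (Num.truncn `|D x|).+1 => // m /= mD'.
    rewrite /X /trunc_tail -/(D x); congr (_ `^ _)%:E; apply/min_idPl.
    by apply: le_trans (ltW (truncnS_gt _)) _; rewrite ler_nat.
  rewrite monotone_convergence//.
  - apply: lime_le; last by apply: nearW => m; exact: XS.
    apply: ereal_nondecreasing_is_cvgn => n m nm; apply: ge0_le_integral => //.
    + by move=> x _; rewrite lee_fin powR_ge0.
    + by move=> x _; exact: Xnd.
  - by move=> n x _; rewrite lee_fin powR_ge0.
rewrite unlock; apply: (@le_trans _ _ ((S `^ s) `^ s^-1)%E).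
  apply: le_poweR => //; first by rewrite invr_ge0 ltW.
  by apply: integral_ge0 => x _; rewrite lee_fin powR_ge0.
by rewrite -poweRrM divff ?gt_eqF// poweRe1.
Qed.

(** It suffices to bound finite partial sums, in which the truncation level can
    be sent to infinity. *)
Lemma BMO_num_bound f (nu : int -> T -> option nat) :
  P.-integrable setT (EFin \o f) ->
  (BMO_norm P F 1 q alpha f < +oo)%E -> BMO_admissible P F q alpha nu ->
  (BMO_num P F s f nu <= BMO_const%:E *
     (BMO_norm P F 1 q alpha f * lq_norm q (BMO_weight P alpha nu)))%E.
Proof.
move=> fi N1 adm; set W := (_ * (_ * _))%E.
pose c k : R := 2 ^ k * stop_prob P (nu k) `^ a.
pose Y k (m : nat) : R :=
  (\int[P]_x trunc_tail P F f (nu k) m%:R x `^ s) `^ s^-1.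
have c0 k : 0 <= c k by rewrite mulr_ge0 ?powR_ge0// exprz_ge0.
have Y0 k m : 0 <= Y k m by exact: powR_ge0.
apply: (@le_trans _ _ (\esum_(k in [set: int])
    ((c k)%:E * ereal_sup (range (fun m => (Y k m)%:E))))%E).
  apply: le_esum => k _; rewrite (Lnorm_sub_stopped s0 fi (adm.1 k)).
  by apply: lee_wpmul2l; [rewrite lee_fin; exact: c0|exact: (Lnorm_trunc_sup fi (adm.1 k))].
apply: ge_ereal_sup => _ [J [finJ _] <-]; rewrite fsbig_finite//=.
have Ynd k : {homo (fun m => (Y k m)%:E) : n m / (n <= m)%N >-> (n <= m)%E}.
  move=> n m nm; rewrite lee_fin /Y; apply: ge0_ler_powR.
  - by rewrite invr_ge0 ltW.
  - by rewrite nnegrE; apply: Rintegral_ge0 => x _; exact: powR_ge0.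
  - by rewrite nnegrE; apply: Rintegral_ge0 => x _; exact: powR_ge0.
  have XI (j : nat) := trunc_tail_integrable (ler0n R j) fi (adm.1 k).
  apply: (le_Rintegral measurableT (XI n) (XI m)) => x _.
  by apply: trunc_tail_homo; rewrite ?ler_nat.
have cv : (\sum_(k <- fset_set J) ((c k)%:E * (Y k m)%:E))%E @[m --> \oo] -->
    (\sum_(k <- fset_set J) ((c k)%:E * ereal_sup (range (fun m => (Y k m)%:E))))%E.
  apply: cvg_nnesum.
    by move=> k _; apply: nearW => m; rewrite mule_ge0 ?lee_fin.
  by move=> k _; apply: cvgeZl => //; exact: ereal_nondecreasing_cvgn.
apply: (cvge_to_le cv); apply: nearW => m.
apply: le_trans (truncated_bound (ler0n R m) fi N1 adm).
by rewrite -fsbig_finite//; apply: esum_ge; exists J.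
Qed.

Lemma BMO_norm_le_norm1 f : P.-integrable setT (EFin \o f) ->
  (BMO_norm P F 1 q alpha f < +oo)%E ->
  (BMO_norm P F s q alpha f <= BMO_const%:E * BMO_norm P F 1 q alpha f)%E.
Proof.
move=> fi N1; apply: ge_ereal_sup => _ [nu adm <-].
apply: BMO_ratio_le => //.
  by apply: mule_ge0; [rewrite lee_fin ltW// BMO_const_gt0|exact: BMO_norm_ge0].
by rewrite -muleA; exact: BMO_num_bound.
Qed.

End exponent.

End bmo.

Section membership.
Context d (T : measurableType d) (R : realType) (P : probability T R).
Variable F : nat -> set (set T).
Hypothesis Pcomplete : measure_is_complete P.
Hypothesis Fs : forall n, sub_sigma (F n).
Hypothesis Fmono : forall m n, (m <= n)%N -> F m `<=` F n.
Hypothesis Fgen : (measurable : set (set T)) = <<s \bigcup_n F n >>.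
Variables (q alpha : R).
Hypothesis q0 : 0 < q.
Hypothesis alpha0 : 0 <= alpha.
Implicit Types (f : T -> R).

(** Since f starts at 0, the sequence whose only finite stopping time is 0 has
    tail f, so it tests the norm of f itself. *)
Lemma BMO_norm_Lfun (s : R) f : 0 < s -> P.-integrable setT (EFin \o f) ->
  (\forall x \ae P, martingale_of P F f 0%N x = 0) ->
  (BMO_norm P F s q alpha f < +oo)%E -> f \in Lfun P s%:E.
Proof.
move=> s0 fi f0 N1; have mf := integrable_measurable fi.
pose nu (k : int) (_ : T) : option nat := if k == 0 then Some 0%N else None.
have B0 : stopped_set (nu 0) = setT by apply/seteqP; split.
have BN k : k != 0 -> nu k = fun=> None.
  by move=> k0; apply/funext => x; rewrite /nu (negPf k0).
have st k : stopping_time F (nu k).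
  have [->|k0] := eqVneq k 0; last by rewrite BN//; exact: never_stopping.
  by move=> n; rewrite (_ : [set x | _] = setT);
    [exact: (sub_sigmaT (Fs n))|apply/seteqP; split].
have wE k : BMO_weight P alpha nu k = (k == 0)%:R.
  rewrite /BMO_weight; have [->|k0] := eqVneq k 0.
    by rewrite B0 probability_setT powR1 mulr1 expr0z.
  rewrite BN// -/(stop_prob P (fun=> None)) never_stop_prob powR0 ?mulr0//.
  by rewrite gt_eqF// ltr_pwDl.
have lE : (lq_norm q (BMO_weight P alpha nu) = 1)%E.
  rewrite /lq_norm [X in (X `^ _)%E](_ : _ = 1%E) ?poweR1r//.
  transitivity (\esum_(k in [set (0 : int)]) 1%:E : \bar R)%E; last by rewrite esum_set1.
  rewrite [RHS]esum_mkcond; apply: eq_esum => k _; rewrite wE.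
  have [->|k0] := eqVneq k 0; first by rewrite mem_set// normr1 powR1.
  by rewrite memNset ?normr0 ?powR0 ?gt_eqF//; exact/eqP.
have adm : BMO_admissible P F q alpha nu by split; [exact: st|rewrite lE ltry].
have := BMO_num_le N1 adm; rewrite lE mule1 => num.
apply/andP; split; apply: mem_set; first exact: mf.
rewrite /finite_norm; apply: le_lt_trans N1; apply: le_trans num.
apply: esum_ge; exists [set (0 : int)]; first by split.
rewrite fsbig_set1 B0 probability_setT powR1 mulr1 expr0z mul1e.
rewrite (@Lnorm_ae_eq _ _ _ _ Pcomplete s f _ s0 mf)//.
apply: filterS2 f0 (sub_stopped_ae Fs Fmono Fgen (nu 0) fi) => x fx ->.
by rewrite /stop_at /stopped_value /= fx subr0.
Qed.

Lemma BMO_integrable (r : R) f : 1 <= r -> BMO P F r q alpha f ->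
  P.-integrable setT (EFin \o f).
Proof.
move=> r1 [fr _ _]; apply/Lfun1_integrable; apply: (Lfun_subset _ _ _ _ fr) => //.
exact: fin_num_measure.
Qed.

Lemma BMO_sub1 (r : R) f : 1 <= r -> BMO P F r q alpha f ->
  BMO P F 1 q alpha f /\
  (BMO_norm P F 1 q alpha f <= BMO_norm P F r q alpha f)%E.
Proof.
move=> r1 bf; have fi := BMO_integrable r1 bf; have [fr f0 N] := bf.
have le1 := BMO_norm1_le_norm Pcomplete Fs Fmono Fgen q alpha r1 fi.
split; last exact: le1.
by split; [exact/Lfun1_integrable|exact: f0|exact: (le_lt_trans le1 N)].
Qed.

(** The constant of regularity is enlarged to be at least 1: it must also bound
    increments that involve no jump. *)
Lemma BMO1_sub (s : R) : regular_basis P F -> 1 <= s ->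
  exists2 C : R, 0 < C & forall f, BMO P F 1 q alpha f ->
  BMO P F s q alpha f /\
  (BMO_norm P F s q alpha f <= C%:E * BMO_norm P F 1 q alpha f)%E.
Proof.
move=> [K0 K0gt Kreg0]; rewrite le_eqVlt => /predU1P[<-|s1].
  by exists 1 => // f bf; rewrite mul1e.
pose K := Num.max K0 1.
have K1 : 1 <= K by rewrite le_max lexx orbT.
have Kreg : jump_bound P F K.
  move=> g mg g0 n; apply: filterS2 (g0 n) (Kreg0 g mg g0 n) => x gx /le_trans; apply.
  by rewrite ler_wpM2r// le_max lexx.
exists (BMO_const K s); first exact: BMO_const_gt0.
move=> f bf; have fi := BMO_integrable (lexx 1) bf; have [_ f0 N] := bf.
have le1 := BMO_norm_le_norm1 Pcomplete Fs Fmono Fgen q0 alpha0 K1 Kreg s1 fi N.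
split; last exact: le1.
have Ns : (BMO_norm P F s q alpha f < +oo)%E.
  apply: (le_lt_trans le1).
  have := BMO_norm_ge0 P 1 f Fs q0 alpha0.
  by move: N; case: BMO_norm => [x| |]// _ _; rewrite -EFinM ltry.
split; [|exact: f0|exact: Ns].
by apply: (BMO_norm_Lfun _ fi f0 Ns); exact: lt_trans s1.
Qed.

End membership.

Unset Implicit Arguments.

Theorem theorem1p2 (R : realType) (d : measure_display) (T : measurableType d)
    (P : probability T R) (F : nat -> set (set T)) (r q alpha : R) :
  measure_is_complete P ->
  stochastic_basis F ->
  regular_basis P F ->
  1 <= q -> 0 <= alpha -> 1 <= r ->
  BMO P F r q alpha = BMO P F 2 q alpha /\
  exists C1 C2 : R,
    [/\ 0 < C1, 0 < C2 &
        forall f : T -> R, BMO P F 2 q alpha f ->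
          (C1%:E * BMO_norm P F 2 q alpha f <= BMO_norm P F r q alpha f)%E /\
          (BMO_norm P F r q alpha f <= C2%:E * BMO_norm P F 2 q alpha f)%E].
Proof.
move=> Pc [Fsig Fm Fmono Fgen] reg q1 alpha0 r1.
have Fs n : sub_sigma (F n) by split; [exact: Fsig|exact: Fm].
have q0 : 0 < q by exact: lt_le_trans q1.
have r2 : (1 : R) <= 2 by rewrite ler1n.
have down (s : R) f := @BMO_sub1 _ _ _ P F Pc Fs Fmono Fgen q alpha s f.
have [Cr Cr0 upr] := BMO1_sub Pc Fs Fmono Fgen q0 alpha0 reg r1.
have [C2 C20 up2] := BMO1_sub Pc Fs Fmono Fgen q0 alpha0 reg r2.
split.
  apply/seteqP; split => f bf.
    by have [b1 _] := down r f r1 bf; have [] := up2 f b1.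
  by have [b1 _] := down 2 f r2 bf; have [] := upr f b1.
exists C2^-1, Cr; split; [by rewrite invr_gt0|exact: Cr0|].
move=> f b2; have [b1 le12] := down 2 f r2 b2.
have [br ler] := upr f b1; have [_ le2] := up2 f b1.
have [_ le1r] := down r f r1 br.
have scale (C : R) (x y : \bar R) : 0 < C -> (x <= y)%E -> (C%:E * x <= C%:E * y)%E.
  by move=> C0; apply: lee_wpmul2l; rewrite lee_fin ltW.
split; last exact: (le_trans ler (scale _ _ _ Cr0 le12)).
have C2V : 0 < C2^-1 by rewrite invr_gt0.
have cancel (x : \bar R) : (C2^-1%:E * (C2%:E * x) = x)%E.
  by rewrite muleA -EFinM mulVf ?gt_eqF// mul1e.
apply: (le_trans (scale _ _ _ C2V (le_trans le2 (scale _ _ _ C20 le1r)))).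
rewrite (cancel (BMO_norm P F r q alpha f)); exact: lexx.
Qed.
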